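(* Let $R$ be a local ring with residue field $k$, and let $\mathcal{X}$ be a resolving subcategory of $\mathrm{mod}\,R$ closed under cosyzygies (i.e. $\Omega^{-1}M\in\mathcal{X}$ for all $M\in\mathcal{X}$). Then $k\in\mathcal{X}$ or $\mathcal{X}\subseteq\mathcal{G}(R)$. In particular, if $\dim R>0$ and $\mathcal{X}$ has finite radius, then $\mathcal{X}\subseteq\mathcal{G}(R)$, and if moreover $R$ is Cohen--Macaulay then $\mathcal{X}$ is contained in the subcategory $\mathrm{CM}(R)$ of maximal Cohen--Macaulay $R$-modules.
   Context: $R$ is a commutative Noetherian local ring; all modules are finitely generated; $\mathrm{mod}\,R$ is the category of finitely generated $R$-modules; subcategories are full and closed under isomorphism. $(-)^*=\mathrm{Hom}_R(-,R)$. $\mathrm{CM}(R)$ includes the zero module. A subcategory $\mathcal{X}$ of $\mathrm{mod}\,R$ is resolving if it contains all finitely generated projective $R$-modules and is closed under direct summands, extensions, and kernels of epimorphisms. $\mathcal{G}(R)$ is the subcategory of totally reflexive modules: those $M$ for which the natural map $M\to M^{**}$ is bijective and $\mathrm{Ext}^i_R(M,R)=\mathrm{Ext}^i_R(M^*,R)=0$ for all $i>0$. Cosyzygy: a left $\mathrm{add}(R)$-approximation of $M$ is a homomorphism $f:M\to P$ with $P$ finitely generated projective such that every homomorphism from $M$ to a finitely generated projective module factors through $f$; it is minimal if every endomorphism $g$ of $P$ with $gf=f$ is an automorphism. $\Omega^{-1}M$ is the cokernel of a minimal left $\mathrm{add}(R)$-approximation of $M$. Radius: $\Omega M$ denotes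 the kernel of a projective cover of $M$, $\Omega^0M=M$, $\Omega^{n}M=\Omega(\Omega^{n-1}M)$. For a subcategory $\mathcal{Y}$, $\mathrm{add}\,\mathcal{Y}$ consists of direct summands of finite direct sums of modules in $\mathcal{Y}$, and $[\mathcal{Y}]=\mathrm{add}\{R,\Omega^iY\mid Y\in\mathcal{Y},\,i\ge0\}$. For subcategories $\mathcal{Y},\mathcal{Z}$, $\mathcal{Y}\circ\mathcal{Z}$ consists of the modules $M$ fitting into an exact sequence $0\to Y\to M\to Z\to0$ with $Y\in\mathcal{Y}$, $Z\in\mathcal{Z}$. For a module $C$ put $[C]_1=[\{C\}]$ and $[C]_n=\big[[C]_{n-1}\circ[C]_1\big]$ for $n>1$. The radius of $\mathcal{X}$ is the infimum of the integers $n\ge0$ such that $\mathcal{X}\subseteq[C]_{n+1}$ for some $R$-module $C$. *)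

(* Defs.v *)
From HB Require Import structures.
From mathcomp Require Import all_boot all_order all_algebra.
From mathcomp Require Import boolp.

Set Implicit Arguments.
Unset Strict Implicit.
Unset Printing Implicit Defensive.

Import GRing.Theory.
Local Open Scope ring_scope.

(* Predicates on modules stand for full subcategories.  Kernels, cokernels,
   syzygies and cosyzygies are relations rather than functions: each of them
   determines a module up to isomorphism only, and the subcategories it is
   applied to are closed under isomorphism. *)
Definition subcat (R : comNzRingType) := lmodType R -> Prop.

Definition subcat_le (R : comNzRingType) (X Y : subcat R) : Prop :=
  forall M, X M -> Y M.

Section Modules.
Variable R : comNzRingType.
Implicit Types (L M N P : lmodType R) (X Y Z : subcat R).

Definition iso M N : Prop := exists f : {linear M -> N}, bijective f.

Definition onto (A B : Type) (f : A -> B) : Prop := forall y, exists x, f x = y.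

Definition lin_span M (s : seq M) (x : M) : Prop :=
  exists c : nat -> R, x = \sum_(i < size s) c i *: s`_i.

Definition fin_gen M : Prop := exists s : seq M, forall x, lin_span s x.

Definition zero_module M : Prop := forall x : M, x = 0.

Definition exact_at L M N (f : {linear L -> M}) (g : {linear M -> N}) : Prop :=
  forall y, g y = 0 <-> exists x, f x = y.

Definition short_exact L M N (f : {linear L -> M}) (g : {linear M -> N}) : Prop :=
  [/\ injective f, exact_at f g & onto g].

Definition summand M N : Prop := exists M' : lmodType R, iso N (M * M')%type.

Definition projective P : Prop :=
  forall M N (g : {linear M -> N}) (h : {linear P -> N}), onto g ->
  exists h' : {linear P -> M}, forall x, g (h' x) = h x.

Definition fg_projective P : Prop := fin_gen P /\ projective P.

(* The first two fields say that X is a subcategory of mod R that is closed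
   under isomorphism. *)
Record resolving X : Prop := {
  resolving_fg : forall M, X M -> fin_gen M;
  resolving_iso : forall M N, iso M N -> X M -> X N;
  resolving_proj : forall P, fg_projective P -> X P;
  resolving_summand : forall M N, summand M N -> X N -> X M;
  resolving_ext : forall L M N (f : {linear L -> M}) (g : {linear M -> N}),
    short_exact f g -> X L -> X N -> X M;
  resolving_ker : forall L M N (f : {linear L -> M}) (g : {linear M -> N}),
    short_exact f g -> X M -> X N -> X L }.

(* For finitely generated modules, add(R) is the category of finitely
   generated projective modules. *)
Definition left_approx M P (f : {linear M -> P}) : Prop :=
  fg_projective P /\
  forall Q, fg_projective Q -> forall h : {linear M -> Q},
    exists g : {linear P -> Q}, forall x, g (f x) = h x.

Definition minimal_left_approx M P (f : {linear M -> P}) : Prop :=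
  left_approx f /\
  forall g : {linear P -> P}, (forall x, g (f x) = f x) -> bijective g.

Definition is_cosyzygy M N : Prop :=
  exists (P : lmodType R) (f : {linear M -> P}) (q : {linear P -> N}),
    [/\ minimal_left_approx f, exact_at f q & onto q].

Definition closed_under_cosyzygies X : Prop :=
  forall M N, is_cosyzygy M N -> X M -> X N.

(* A projective cover is an epimorphism from a projective module whose kernel
   is superfluous. *)
Definition projective_cover P M (p : {linear P -> M}) : Prop :=
  [/\ fg_projective P, onto p &
      forall S : {pred P}, submod_closed S ->
        (forall x, exists s n, [/\ s \in S, p n = 0 & x = s + n]) ->
        forall x, x \in S].

Definition is_syzygy M N : Prop :=
  exists (P : lmodType R) (i : {linear N -> P}) (p : {linear P -> M}),
    projective_cover p /\ short_exact i p.

Fixpoint is_nsyzygy (n : nat) M N : Prop :=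
  match n with
  | 0%N => iso M N
  | n'.+1 => exists2 L, is_nsyzygy n' M L & is_syzygy L N
  end.

Inductive fin_dsum Y : lmodType R -> Prop :=
  | FinDsum0 M of zero_module M : fin_dsum Y M
  | FinDsumS M L N of Y L & fin_dsum Y N & iso M (L * N)%type : fin_dsum Y M.

Definition add_closure Y : subcat R :=
  fun M => exists2 N, fin_dsum Y N & summand M N.

Definition bracket Y : subcat R :=
  add_closure (fun M => iso R^o M \/
                        exists2 N, Y N & exists i, is_nsyzygy i N M).

Definition circ Y Z : subcat R := fun M =>
  exists (L N : lmodType R) (f : {linear L -> M}) (g : {linear M -> N}),
    [/\ Y L, Z N & short_exact f g].

(* radius_ball C n is the subcategory usually written [C]_{n+1}. *)
Fixpoint radius_ball (C : lmodType R) (n : nat) : subcat R :=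
  match n with
  | 0%N => bracket (iso C)
  | n'.+1 => bracket (circ (radius_ball C n') (bracket (iso C)))
  end.

Definition in_radius_ball X (n : nat) : Prop :=
  exists2 C : lmodType R, fin_gen C & subcat_le X (radius_ball C n).

Definition is_radius X (r : nat) : Prop :=
  in_radius_ball X r /\ forall n, in_radius_ball X n -> (r <= n)%N.

Definition finite_radius X : Prop := exists r, is_radius X r.

End Modules.

Definition homR (R : comNzRingType) (M N : lmodType R) : Type := {linear M -> N}.

Section HomModule.
Variables (R : comNzRingType) (M N : lmodType R).
Implicit Types f g h : homR M N.

HB.instance Definition _ := gen_eqMixin (homR M N).
HB.instance Definition _ := gen_choiceMixin (homR M N).

Definition hom_zero : homR M N := (\0 : M -> N) : {linear M -> N}.
Definition hom_add f g : homR M N := (f \+ g : M -> N) : {linear M -> N}.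
Definition hom_opp f : homR M N := (\- f : M -> N) : {linear M -> N}.
Definition hom_scale (a : R) f : homR M N := (a \*: f : M -> N) : {linear M -> N}.

Lemma homP f g : (f : {linear M -> N}) =1 (g : {linear M -> N}) -> f = g.
Proof.
case: f g => [f [[f1] [f2]]] [g [[g1] [g2]]] /= /funext efg.
subst g; congr GRing.Linear.Pack; congr GRing.Linear.Class.
  by congr Algebra.isNmodMorphism.Axioms_; apply: Prop_irrelevance.
by congr GRing.isScalable.Axioms_; apply: Prop_irrelevance.
Qed.

Lemma hom_addA : associative hom_add.
Proof. by move=> f g h; apply: homP => x /=; rewrite addrA. Qed.
Lemma hom_addC : commutative hom_add.
Proof. by move=> f g; apply: homP => x /=; rewrite addrC. Qed.
Lemma hom_add0 : left_id hom_zero hom_add.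
Proof. by move=> f; apply: homP => x /=; rewrite add0r. Qed.
Lemma hom_addN : left_inverse hom_zero hom_opp hom_add.
Proof. by move=> f; apply: homP => x /=; rewrite addNr. Qed.

HB.instance Definition _ :=
  GRing.isZmodule.Build (homR M N) hom_addA hom_addC hom_add0 hom_addN.

Lemma hom_scaleA a b f : hom_scale a (hom_scale b f) = hom_scale (a * b) f.
Proof. by apply: homP => x /=; rewrite scalerA. Qed.
Lemma hom_scale1 : left_id 1 hom_scale.
Proof. by move=> f; apply: homP => x /=; rewrite scale1r. Qed.
Lemma hom_scaleDr : right_distributive hom_scale +%R.
Proof. by move=> a f g; apply: homP => x /=; rewrite scalerDr. Qed.
Lemma hom_scaleDl f a b : hom_scale (a + b) f = hom_scale a f + hom_scale b f.
Proof. by apply: homP => x /=; rewrite scalerDl. Qed.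

HB.instance Definition _ :=
  GRing.Zmodule_isLmodule.Build R (homR M N)
    hom_scaleA hom_scale1 hom_scaleDr hom_scaleDl.

End HomModule.

Section TotallyReflexive.
Variable R : comNzRingType.
Implicit Types M N : lmodType R.

Definition dual M : lmodType R := homR M R^o.

Section Biduality.
Variables (M : lmodType R) (x : M).

Definition eval_at (f : dual M) : R^o := (f : {linear M -> R^o}) x.

Lemma eval_at_linear : linear eval_at. Proof. by []. Qed.

HB.instance Definition _ :=
  GRing.isLinear.Build R (dual M) R^o _ eval_at eval_at_linear.

End Biduality.

Definition biduality M (x : M) : dual (dual M) :=
  (eval_at x : {linear dual M -> R^o}).

Record proj_resolution M := ProjResolution {
  res_mod : nat -> lmodType R;
  res_diff : forall i, {linear res_mod i.+1 -> res_mod i};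
  res_aug : {linear res_mod 0 -> M};
  res_proj : forall i, projective (res_mod i);
  res_aug_onto : onto res_aug;
  res_exact0 : exact_at (res_diff 0) res_aug;
  res_exact : forall i, exact_at (res_diff i.+1) (res_diff i) }.

(* Every i-cocycle of the complex Hom(P, N) is a coboundary. *)
Definition Hom_cohomology_eq0 M N (P : proj_resolution M) (i : nat) : Prop :=
  forall f : {linear res_mod P i -> N},
    (forall x, f (res_diff P i x) = 0) ->
    match i return {linear res_mod P i -> N} -> Prop with
    | 0%N => fun f => forall x, f x = 0
    | j.+1 => fun f => exists g : {linear res_mod P j -> N},
                         forall x, g (res_diff P j x) = f x
    end f.

(* Ext^i(M, N) = 0; this does not depend on the projective resolution. *)
Definition Ext_eq0 (i : nat) M N : Prop :=
  exists P : proj_resolution M, Hom_cohomology_eq0 N P i.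

Definition totally_reflexive : subcat R := fun M =>
  [/\ fin_gen M,
      bijective (@biduality M),
      forall i, (0 < i)%N -> Ext_eq0 i M R^o
    & forall i, (0 < i)%N -> Ext_eq0 i (dual M) R^o].

End TotallyReflexive.

Section LocalRings.
Variable R : comNzRingType.
Implicit Types (I p m : {pred R}) (M : lmodType R).

(* The ideals of R are the submodules of R^o, the unit ideal included. *)
Definition noetherian : Prop :=
  forall I : {pred R^o}, submod_closed I ->
  exists s : seq R^o, forall x, x \in I <-> lin_span s x.

(* idealr_closed includes 1 \notin I. *)
Definition maximal_ideal m : Prop :=
  idealr_closed m /\
  forall I, idealr_closed I -> {subset m <= I} -> {subset I <= m}.

Definition local_ring m : Prop :=
  maximal_ideal m /\ forall m', maximal_ideal m' -> m' =i m.

(* M is isomorphic to R/m. *)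
Definition residue_field m M : Prop :=
  exists q : {linear R^o -> M}, onto q /\ forall a, q a = 0 <-> a \in m.

Definition prime_ideal p : Prop := idealr_closed p /\ prime_idealr_closed p.

Definition prime_chain (n : nat) : Prop :=
  exists p : nat -> {pred R},
    (forall i, (i <= n)%N -> prime_ideal (p i)) /\
    (forall i, (i < n)%N ->
       {subset p i <= p i.+1} /\ ~ {subset p i.+1 <= p i}).

Definition is_krull_dim (d : nat) : Prop :=
  prime_chain d /\ forall n, prime_chain n -> (n <= d)%N.

(* The dimension is the supremum of the lengths of chains of primes, so it
   exceeds n as soon as some chain is longer than n. *)
Definition krull_dim_gt (n : nat) : Prop :=
  exists2 d, (n < d)%N & prime_chain d.

(* x \in (s)M *)
Definition in_ideal_mul M (s : seq R) (x : M) : Prop :=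
  exists c : nat -> M, x = \sum_(i < size s) s`_i *: c i.

Definition regular_sequence M (s : seq R) : Prop :=
  (forall i, (i < size s)%N -> forall x : M,
     in_ideal_mul (take i s) (s`_i *: x) -> in_ideal_mul (take i s) x) /\
  exists x : M, ~ in_ideal_mul s x.

Definition is_depth m M (d : nat) : Prop :=
  (exists s, [/\ {subset s <= m}, regular_sequence M s & size s = d]) /\
  forall s, {subset s <= m} -> regular_sequence M s -> (size s <= d)%N.

Definition maximal_CM m : subcat R := fun M =>
  fin_gen M /\
  (zero_module M \/ exists2 d, is_krull_dim d & is_depth m M d).

Definition CM_ring m : Prop :=
  exists2 d, is_krull_dim d & is_depth m R^o d.

End LocalRings.

(* Main.v *)
Require Import Defs.
From HB Require Import structures.
From mathcomp Require Import all_boot all_order all_algebra.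
From mathcomp Require Import boolp.

Set Implicit Arguments.
Unset Strict Implicit.
Unset Printing Implicit Defensive.

(** Let m be the maximal ideal of R, and let the torsion of a module M be the set
    of elements annihilated by all functionals M -> R, that is, the kernel of
    biduality. The kernel of a left approximation f : M -> P is the torsion of M,
    and its image is the kernel of P -> Cosyz(M); hence X contains with M both its
    torsion and its torsionless quotient ([torsion_sequence]). So if the torsion of
    a module of X is nonzero and killed by m, then it is a vector space over k and
    k is in X. The dichotomy rests on producing such torsion; suppose from now on
    that k is not in X.

    Let L be the syzygy of M in X, with L inside the free module F, and let
    z_1, ..., z_r generate m. The pushout E of F along L -> L^r, l |-> (z_j l)_j,
    is an extension of M by L^r, so it is in X, and its torsion is killed by m;
    hence E is torsionless. The restriction map Ext^1(M, R) -> Ext^1(E, R) has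
    kernel m Ext^1(M, R), so by Nakayama it is nonzero as soon as Ext^1(M, R) is,
    and its image is killed by m.

    - If M is torsionless and Ext^1(M, R) is nonzero ([torsionless_ext1_zero]), a
      nonzero class in this image gives an extension G of E by R on which the values
      of functionals at the generator e of R form exactly m. Again G is torsionless;
      it embeds in its left approximation P, with e in mP, and W = P/Re lies in X.
      Multiplication by elements of m factors on W through a free module, a property
      that passes to cosyzygies and forces the torsion to be killed by m. So all
      iterated cosyzygies of W are torsionless, and 0 -> R -> P -> W continues to an
      infinite exact sequence of free modules.
    - If K is the torsion of a module of X ([resolving_torsionless]), then the first
      case gives K* = 0 and Ext^1(K, R) = 0, so that F* = L*; dualizing a free
      resolution of L gives again an infinite exact sequence that starts with a free
      module mapping into m times the next one, unless K = 0.

    Such sequences do not exist ([no_infinite_coresolution]): a regular sequence on R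
    is regular on high syzygies, and one compares socles modulo a maximal regular
    sequence. This is the bound of finite projective dimensions by the depth in
    disguise. Hence every module of X is torsionless with Ext^1(-, R) = 0, and total
    reflexivity follows formally from the closure of X under syzygies and cosyzygies.

    If the radius of X is finite, then a fixed power of m annihilates the m-power
    torsion of every module in X, because extensions add up the exponents and
    syzygies embed in free modules ([torsion_bound_ball]). If moreover k is in X,
    then so are all R/m^t, and m is nilpotent ([torsion_bound_dim0]).

    Finally a totally reflexive module is an arbitrarily high syzygy, so a maximal
    regular sequence on a Cohen-Macaulay ring R is regular on it; and regular
    sequences are not longer than chains of primes ([regular_sequence_chain]). *)

Import GRing.Theory.
Local Open Scope ring_scope.

(** * Linear maps, submodules and quotients *)

Section LinearMaps.
Variable R : comNzRingType.
Implicit Types (K L M N : lmodType R).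

Definition mk_linear M N (f : M -> N) (hf : linear f) : {linear M -> N} :=
  HB.pack f (GRing.isLinear.Build R M N _ f hf).

Definition is_submod M (S : M -> Prop) : Prop :=
  S 0 /\ forall a x y, S x -> S y -> S (a *: x + y).

Lemma submodD M (S : M -> Prop) x y : is_submod S -> S x -> S y -> S (x + y).
Proof. by move=> [_ h] hx hy; rewrite -[x]scale1r; apply: h. Qed.

Lemma submodZ M (S : M -> Prop) a x : is_submod S -> S x -> S (a *: x).
Proof. by move=> [h0 h] hx; rewrite -[_ *: _]addr0; apply: h. Qed.

Lemma submodN M (S : M -> Prop) x : is_submod S -> S x -> S (- x).
Proof. by move=> h hx; rewrite -scaleN1r; apply: submodZ. Qed.

Lemma submodB M (S : M -> Prop) x y : is_submod S -> S x -> S y -> S (x - y).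
Proof. by move=> h hx hy; apply: submodD => //; apply: submodN. Qed.

Lemma submod_sum M (S : M -> Prop) n (F : 'I_n -> M) :
  is_submod S -> (forall i, S (F i)) -> S (\sum_i F i).
Proof.
move=> h hF; apply: big_ind => //; first by case: h.
by move=> x y; apply: submodD.
Qed.

Section Submodule.
Variables (M : lmodType R) (S : {pred M}) (hS : submod_closed S).

Definition submodule of submod_closed S := {x : M | x \in S}.
Local Notation T := (submodule hS).
HB.instance Definition _ := SubChoice.on T.
HB.instance Definition _ := GRing.SubChoice_isSubLmodule.Build R M S T hS.

End Submodule.

Section Quotient.
Variables (M : lmodType R) (S : M -> Prop) (hS : is_submod S).

Definition coset_rep (x : M) : M := choose (fun y => `[<S (x - y)>]) x.

Lemma coset_repP x : S (x - coset_rep x).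
Proof.
apply/asboolP/(@chooseP _ (fun y => `[<S (x - y)>])).
by apply/asboolP; rewrite subrr; case: hS.
Qed.

Lemma coset_rep_eq x y : S (x - y) -> coset_rep x = coset_rep y.
Proof.
move=> hxy; rewrite /coset_rep.
have e : (fun z => `[<S (x - z)>]) =1 (fun z => `[<S (y - z)>]).
  move=> z; apply/asbool_equiv_eq; split=> h.
    rewrite (_ : y - z = (x - z) - (x - y)); first exact: submodB.
    by rewrite opprB [RHS]addrC subrKA.
  by rewrite -(subrK y x) -addrA; apply: submodD.
rewrite (eq_choose e); apply: choose_id; apply/asboolP.
  rewrite -opprB; exact: submodN.
by rewrite subrr; case: hS.
Qed.

Lemma coset_rep_id x : coset_rep (coset_rep x) = coset_rep x.
Proof. by apply: coset_rep_eq; rewrite -opprB; apply: submodN => //; apply: coset_repP. Qed.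

Lemma coset_repE x y : coset_rep x = coset_rep y -> S (x - y).
Proof.
move=> e; rewrite -(subrK (coset_rep x) x) -addrA {2}e.
apply: submodD (coset_repP x) _ => //; rewrite -opprB; apply: submodN => //.
exact: coset_repP.
Qed.

(** The carrier consists of the chosen representatives of the cosets. *)
Definition quotient of is_submod S := {x : M | coset_rep x == x}.
Local Notation T := (quotient hS).
HB.instance Definition _ := SubChoice.on T.

Definition quot_proj (x : M) : T := exist _ (coset_rep x) (introT eqP (coset_rep_id x)).

Lemma quot_proj_val (x : T) : quot_proj (val x) = x.
Proof. by apply: val_inj; apply/eqP; case: x. Qed.

Lemma quot_projE x y : S (x - y) -> quot_proj x = quot_proj y.
Proof. by move=> h; apply: val_inj; apply: coset_rep_eq. Qed.

Lemma val_quot_proj x : S (val (quot_proj x) - x).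
Proof. by rewrite -opprB; apply: submodN => //; apply: coset_repP. Qed.

Definition quot_zero := quot_proj 0.
Definition quot_add (x y : T) := quot_proj (val x + val y).
Definition quot_opp (x : T) := quot_proj (- val x).
Definition quot_scale (a : R) (x : T) := quot_proj (a *: val x).

Lemma quot_addE x y : quot_add (quot_proj x) (quot_proj y) = quot_proj (x + y).
Proof. by apply: quot_projE; rewrite opprD addrACA; apply: submodD => //; apply: val_quot_proj. Qed.
Lemma quot_oppE x : quot_opp (quot_proj x) = quot_proj (- x).
Proof. by apply: quot_projE; rewrite -opprD; apply: submodN => //; apply: val_quot_proj. Qed.
Lemma quot_scaleE a x : quot_scale a (quot_proj x) = quot_proj (a *: x).
Proof. by apply: quot_projE; rewrite -scalerBr; apply: submodZ => //; apply: val_quot_proj. Qed.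

Lemma quot_addA : associative quot_add.
Proof.
move=> x y z; rewrite -(quot_proj_val x) -(quot_proj_val y) -(quot_proj_val z).
by rewrite !quot_addE addrA.
Qed.
Lemma quot_addC : commutative quot_add.
Proof. by move=> x y; rewrite /quot_add addrC. Qed.
Lemma quot_add0 : left_id quot_zero quot_add.
Proof. by move=> x; rewrite -(quot_proj_val x) quot_addE add0r. Qed.
Lemma quot_addN : left_inverse quot_zero quot_opp quot_add.
Proof. by move=> x; rewrite -(quot_proj_val x) quot_oppE quot_addE addNr. Qed.

HB.instance Definition _ :=
  GRing.isZmodule.Build T quot_addA quot_addC quot_add0 quot_addN.

Lemma quot_scaleA a b x : quot_scale a (quot_scale b x) = quot_scale (a * b) x.
Proof. by rewrite -(quot_proj_val x) !quot_scaleE scalerA. Qed.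
Lemma quot_scale1 : left_id 1 quot_scale.
Proof. by move=> x; rewrite -(quot_proj_val x) quot_scaleE scale1r. Qed.
Lemma quot_scaleDr : right_distributive quot_scale +%R.
Proof.
move=> a x y; rewrite -(quot_proj_val x) -(quot_proj_val y).
by rewrite [quot_proj _ + _]quot_addE !quot_scaleE [RHS]quot_addE scalerDr.
Qed.
Lemma quot_scaleDl x a b : quot_scale (a + b) x = quot_scale a x + quot_scale b x.
Proof. by rewrite -(quot_proj_val x) !quot_scaleE [RHS]quot_addE scalerDl. Qed.

HB.instance Definition _ :=
  GRing.Zmodule_isLmodule.Build R T
    quot_scaleA quot_scale1 quot_scaleDr quot_scaleDl.

Lemma quot_proj_linear : linear quot_proj.
Proof. by move=> a x y; rewrite [X in _ = X + _]quot_scaleE [RHS]quot_addE. Qed.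

End Quotient.

Lemma submodule_exists M (S : M -> Prop) : is_submod S ->
  exists (K : lmodType R) (i : {linear K -> M}),
    injective i /\ forall x, S x <-> exists y, i y = x.
Proof.
move=> hS; pose P : {pred M} := fun x => `[<S x>].
have hP : submod_closed P.
  split; first by apply/asboolP; case: hS.
  by move=> a x y /asboolP hx /asboolP hy; apply/asboolP; case: hS => _; apply.
exists (submodule hP), (val : {linear submodule hP -> M}); split; first exact: val_inj.
move=> x; split=> [hx | [y <-]]; last by apply/asboolP; apply: (valP y).
have hx' : x \in P by apply/asboolP.
by exists (exist _ x hx').
Qed.

Lemma quotient_exists M (S : M -> Prop) : is_submod S ->
  exists (Q : lmodType R) (q : {linear M -> Q}),
    onto q /\ forall x, q x = 0 <-> S x.
Proof.
move=> hS; exists (quotient hS), (mk_linear (quot_proj_linear hS)); split.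
  by move=> y; exists (val y); apply: quot_proj_val.
move=> x /=; split=> [/(congr1 val) | h]; last by apply: quot_projE; rewrite subr0.
by move/(coset_repE hS); rewrite subr0.
Qed.

Lemma linear_eq_ker M N (f : {linear M -> N}) x y : f (x - y) = 0 <-> f x = f y.
Proof. by rewrite linearB; split=> [/subr0_eq | ->] //; rewrite subrr. Qed.

Lemma factor_onto L M N (p : {linear L -> M}) (g : {linear L -> N}) :
  onto p -> (forall x, p x = 0 -> g x = 0) ->
  exists h : {linear M -> N}, forall x, h (p x) = g x.
Proof.
move=> hp hg; pose s y := projT1 (cid (hp y)).
have ps y : p (s y) = y by rewrite /s; case: cid.
have gE x y : p x = p y -> g x = g y.
  by move=> e; apply/linear_eq_ker/hg/linear_eq_ker.
have hl : linear (g \o s).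
  by move=> a x y /=; rewrite -linearP; apply: gE; rewrite linearP !ps.
by exists (mk_linear hl) => x; apply: gE; rewrite ps.
Qed.

Lemma factor_inj L M N (i : {linear M -> N}) (g : {linear L -> N}) :
  injective i -> (forall x, exists y, i y = g x) ->
  exists h : {linear L -> M}, forall x, i (h x) = g x.
Proof.
move=> hi hg; pose s y := projT1 (cid (hg y)).
have is_ y : i (s y) = g y by rewrite /s; case: cid.
have hl : linear s by move=> a x y; apply: hi; rewrite linearP !is_ linearP.
by exists (mk_linear hl) => x; apply: is_.
Qed.

Lemma injP M N (f : {linear M -> N}) :
  injective f <-> forall x, f x = 0 -> x = 0.
Proof.
split=> [h x e | h x y e]; first by apply: h; rewrite e linear0.
by apply/subr0_eq/h/linear_eq_ker.
Qed.

Lemma ker_submod M N (f : {linear M -> N}) : is_submod (fun x => f x = 0).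
Proof. by split=> [|a x y ex ey]; rewrite ?linear0 // linearP ex ey scaler0 addr0. Qed.

Lemma im_submod M N (f : {linear M -> N}) : is_submod (fun y => exists x, f x = y).
Proof.
split=> [|a _ _ [x <-] [y <-]]; first by exists 0; rewrite linear0.
by exists (a *: x + y); rewrite linearP.
Qed.

Lemma kernel_exists M N (f : {linear M -> N}) : onto f ->
  exists (K : lmodType R) (i : {linear K -> M}), short_exact i f.
Proof.
move=> hf; have [K [i [hi hK]]] := submodule_exists (ker_submod f).
by exists K, i; split.
Qed.

Lemma exact_comp0 L M N (f : {linear L -> M}) (g : {linear M -> N}) x :
  exact_at f g -> g (f x) = 0.
Proof. by move=> h; apply/h; exists x. Qed.

Lemma bij_linear M N (f : {linear M -> N}) : injective f -> onto f -> bijective f.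
Proof.
move=> hi ho; pose s y := projT1 (cid (ho y)).
have fs y : f (s y) = y by rewrite /s; case: cid.
by exists s => // x; apply: hi; rewrite fs.
Qed.

Lemma iso_of M N (f : {linear M -> N}) : injective f -> onto f -> iso M N.
Proof. by move=> hi ho; exists f; apply: bij_linear. Qed.

Lemma bij_onto M N (f : {linear M -> N}) : bijective f -> onto f.
Proof. by move=> [g _ h] y; exists (g y). Qed.

Lemma iso_inv M N (f : {linear M -> N}) : bijective f ->
  exists g : {linear N -> M}, cancel f g /\ cancel g f.
Proof.
move=> hf; have [g hg] := factor_inj (bij_inj hf)
  (g := idfun : {linear N -> N}) (fun x => bij_onto hf x).
exists g; split=> x; last exact: hg.
by apply: (bij_inj hf); rewrite hg.
Qed.

Lemma iso_sym M N : iso M N -> iso N M.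
Proof.
move=> [f /iso_inv [g [fg gf]]]; exists g; by exists f.
Qed.

End LinearMaps.

Arguments submodule_exists {R M S}.
Arguments quotient_exists {R M S}.

(** * Finite generation and chain conditions *)

Section FiniteGeneration.
Variable R : comNzRingType.
Implicit Types (K L M N : lmodType R).

Lemma span_cons M (a : M) s x :
  lin_span (a :: s) x <-> exists r, lin_span s (x - r *: a).
Proof.
split=> [[c ->] | [r [c e]]].
  exists (c 0%N), (fun i => c i.+1).
  by rewrite big_ord_recl /= addrC addKr; apply: eq_bigr.
exists (fun i => if i is j.+1 then c j else r).
by rewrite big_ord_recl /= -[LHS](subrK (r *: a)) addrC e.
Qed.

Lemma span_submod M (s : seq M) : is_submod (lin_span s).
Proof.
split=> [|a _ _ [c ->] [d ->]].
  by exists (fun=> 0); rewrite big1 // => i _; rewrite scale0r.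
exists (fun i => a * c i + d i); rewrite scaler_sumr -big_split /=.
by apply: eq_bigr => i _; rewrite scalerDl scalerA.
Qed.

Lemma span_mem M (s : seq M) x : x \in s -> lin_span s x.
Proof.
elim: s => // a s IH; rewrite inE => /orP [/eqP -> | /IH h]; apply/span_cons.
  by exists 1; rewrite scale1r subrr; case: (span_submod s).
by exists 0; rewrite scale0r subr0.
Qed.

Lemma span_sub M (S : M -> Prop) s y :
  is_submod S -> (forall x, x \in s -> S x) -> lin_span s y -> S y.
Proof.
move=> hS h [c ->]; apply: submod_sum => // i.
by apply: submodZ => //; apply: h; apply: mem_nth.
Qed.

Lemma span_one (a : R^o) : lin_span [:: (1 : R^o)] a.
Proof.
by exists (fun=> a); rewrite big_ord_recl big_ord0 addr0; apply/esym/mulr1.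
Qed.

Lemma fin_gen_regular : fin_gen R^o.
Proof. by exists [:: (1 : R^o)] => a; apply: span_one. Qed.

Lemma comb_linear M n (x : 'I_n -> M) :
  linear (fun v : 'rV[R]_n => \sum_i v 0 i *: x i).
Proof.
move=> a u v; rewrite scaler_sumr -big_split /=.
by apply: eq_bigr => i _; rewrite !mxE scalerDl scalerA.
Qed.

Definition comb M n (x : 'I_n -> M) : {linear 'rV[R]_n -> M} :=
  mk_linear (comb_linear x).

Lemma comb_delta M n (x : 'I_n -> M) i : comb x (delta_mx 0 i) = x i.
Proof.
rewrite /= (bigD1 i) //= mxE !eqxx scale1r big1 ?addr0 // => j ji.
by rewrite mxE (negbTE ji) andbF scale0r.
Qed.

Lemma linear_rowE M n (f : {linear 'rV[R]_n -> M}) v :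
  f v = \sum_i v 0 i *: f (delta_mx 0 i).
Proof.
rewrite {1}(row_sum_delta v) linear_sum.
by apply: eq_bigr => i _; rewrite linearZ.
Qed.

Lemma fin_genP M : fin_gen M <-> exists n (x : 'I_n -> M), onto (comb x).
Proof.
split=> [[s hs] | [n [x hx]]].
  exists (size s), (fun i : 'I__ => s`_i) => y; have [c ->] := hs y.
  by exists (\row_i c i) => /=; apply: eq_bigr => i _; rewrite mxE.
exists [seq x i | i <- enum 'I_n] => y; have [v <-] := hx y => /=.
apply: submod_sum => [|i]; first exact: span_submod.
apply: submodZ; first exact: span_submod.
by apply: span_mem; apply: map_f; rewrite mem_enum.
Qed.

Lemma fin_gen_onto M N (p : {linear M -> N}) : onto p -> fin_gen M -> fin_gen N.
Proof.
move=> hp [s hs]; exists (map p s) => y; have [x <-] := hp y.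
have [c ->] := hs x; exists c; rewrite linear_sum size_map.
by apply: eq_bigr => i _; rewrite linearZ (nth_map 0).
Qed.

Lemma fin_gen_free n : fin_gen ('rV[R]_n).
Proof.
apply/fin_genP; exists n, (fun i => delta_mx 0 i) => v; exists v => /=.
by rewrite [RHS]row_sum_delta.
Qed.

Definition noeth_module M : Prop :=
  forall S : M -> Prop, is_submod S ->
  exists s : seq M, (forall x, x \in s -> S x) /\ forall x, S x -> lin_span s x.

(** Induction on the number of generators of M: the coefficients of the first
    generator in elements of S form an ideal, and lifting finitely many generators
    of this ideal to S reduces S to a submodule of the span of the other ones. *)
Lemma noeth_fin_gen M : noetherian R -> fin_gen M -> noeth_module M.
Proof.
move=> hR [g hg] S0 hS0.
suff H : forall g (S : M -> Prop), is_submod S -> (forall x, S x -> lin_span g x) ->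
    exists s : seq M, (forall x, x \in s -> S x) /\ forall x, S x -> lin_span s x.
  by apply: (H g).
move=> {g hg S0 hS0}; elim=> [|a g IH] S hS hg.
  by exists [::]; split=> // x /hg.
pose J : {pred R^o} := fun r => `[<exists y, lin_span g y /\ S (r *: a + y)>].
have hJ : submod_closed J.
  split.
    apply/asboolP; exists 0; rewrite scale0r addr0.
    by split; [case: (span_submod g) | case: hS].
  move=> r b c /asboolP [y [y1 y2]] /asboolP [y' [y1' y2']]; apply/asboolP.
  exists (r *: y + y'); split; first by case: (span_submod g) => _; apply.
  have -> : (r *: b + c) *: a + (r *: y + y') = r *: (b *: a + y) + (c *: a + y').
    by rewrite scalerDl scalerDr scalerA addrACA.
  by case: hS => _; apply.
have [t ht] := hR J hJ.
have [w hw] : exists w : nat -> M,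
    forall i, (i < size t)%N -> S (w i) /\ lin_span g (w i - t`_i *: a).
  have h i : exists w, (i < size t)%N -> S w /\ lin_span g (w - t`_i *: a).
    case: (ltnP i (size t)) => hi; last by exists 0.
    have /ht/asboolP [y [y1 y2]] : lin_span t t`_i by apply: span_mem; apply: mem_nth.
    by exists (t`_i *: a + y); split=> //; rewrite addrAC subrr add0r.
  by exists (fun i => projT1 (cid (h i))) => i; case: cid.
have hS' : is_submod (fun x => S x /\ lin_span g x).
  split; first by split; [case: hS | case: (span_submod g)].
  move=> r x y [x1 x2] [y1 y2].
  by split; [case: hS | case: (span_submod g)] => _; apply.
have [s [s1 s2]] := IH _ hS' (fun x => @proj2 _ _).
exists (mkseq w (size t) ++ s); split=> [x|x Sx].
  rewrite mem_cat => /orP [/mapP [i] | /s1 []] //.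
  by rewrite mem_iota add0n => /andP [_ hi] ->; case: (hw i hi).
have hspan := span_submod (mkseq w (size t) ++ s).
have /span_cons [r hr] := hg x Sx.
have /ht [c rE] : r \in J.
  by apply/asboolP; exists (x - r *: a); split=> //; rewrite addrCA subrr addr0.
pose u := \sum_(i < size t) c i *: w i.
have Su : S u by apply: submod_sum => // i; apply: submodZ => //; case: (hw i).
have gu : lin_span g (u - r *: a).
  rewrite rE scaler_suml /u -sumrB; apply: submod_sum; first exact: span_submod.
  move=> i; rewrite -scalerA -scalerBr; apply: submodZ; first exact: span_submod.
  by case: (hw i).
rewrite -(subrK u x); apply: submodD => //; last first.
  apply: submod_sum => // i; apply: submodZ => //; apply: span_mem.
  by rewrite mem_cat; apply/orP; left; apply: map_f; rewrite mem_iota /=.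
apply: (@span_sub _ (lin_span (mkseq w (size t) ++ s)) s) => //.
  by move=> y ys; apply: span_mem; rewrite mem_cat ys orbT.
apply: s2; split; first exact: submodB.
rewrite (_ : x - u = (x - r *: a) - (u - r *: a)).
  by apply: submodB => //; apply: span_submod.
by rewrite opprB subrKA.
Qed.

Lemma fin_gen_inj M N (i : {linear M -> N}) :
  noetherian R -> injective i -> fin_gen N -> fin_gen M.
Proof.
move=> hR hi hN; have [s [s1 s2]] := noeth_fin_gen hR hN (im_submod i).
have [t ts] : exists t : seq M, map i t = s.
  elim: s s1 {s2} => [|a s IH] s1; first by exists [::].
  have [t e] := IH (fun x xs => s1 x (mem_behead (s := a :: s) xs)).
  have [b ab] : exists x, i x = a by apply: s1; rewrite inE eqxx.
  by exists (b :: t); rewrite /= e ab.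
exists t => x; have [c e] := s2 (i x) (ex_intro _ x erefl).
exists c; apply: hi; rewrite e -ts size_map linear_sum.
by apply: eq_bigr => j _; rewrite linearZ (nth_map 0).
Qed.

Lemma noeth_maximal M (C : (M -> Prop) -> Prop) : noeth_module M ->
  (forall S, C S -> is_submod S) -> (exists S, C S) ->
  exists S, C S /\ forall T, C T -> (forall x, S x -> T x) -> forall x, T x -> S x.
Proof.
move=> hM hC [S0 CS0]; apply: contrapT => hno.
have step (S : {S | C S}) : exists T : {S | C S},
    (forall x, proj1_sig S x -> proj1_sig T x) /\
    exists x, proj1_sig T x /\ ~ proj1_sig S x.
  case: S => S CS; apply: contrapT => h; apply: hno; exists S; split=> // T CT ST x Tx.
  apply: contrapT => Sx; apply: h; exists (exist _ T CT); split=> //.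
  by exists x.
pose f S := projT1 (cid (step S)).
have fP S : (forall x, proj1_sig S x -> proj1_sig (f S) x) /\
    exists x, proj1_sig (f S) x /\ ~ proj1_sig S x by rewrite /f; case: cid.
pose ch n := proj1_sig (iter n f (exist _ S0 CS0)).
have chS n : is_submod (ch n) by apply: hC; apply: (proj2_sig (iter n f _)).
have chle n k x : (n <= k)%N -> ch n x -> ch k x.
  move=> /subnKC <-; elim: (k - n)%N => [|d IH]; rewrite ?addn0 // addnS => h.
  exact: (proj1 (fP _)) (IH h).
have hU : is_submod (fun x => exists n, ch n x).
  split; first by exists 0%N; case: (chS 0%N).
  move=> a x y [n hn] [k hk]; exists (maxn n k); case: (chS (maxn n k)) => _; apply.
    by apply: chle hn; rewrite leq_maxl.
  by apply: chle hk; rewrite leq_maxr.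
have [s [s1 s2]] := hM _ hU.
have [b hb] : exists b, forall x, x \in s -> ch b x.
  elim: s s1 {s2} => [|a s IH] s1; first by exists 0%N.
  have [b hb] := IH (fun x xs => s1 x (mem_behead (s := a :: s) xs)).
  have [k hk] : exists k, ch k a by apply: s1; rewrite inE eqxx.
  exists (maxn k b) => x; rewrite inE => /orP [/eqP -> | /hb].
    by apply: chle hk; rewrite leq_maxl.
  by apply: chle; rewrite leq_maxr.
have [x [x1 x2]] := proj2 (fP (iter b f (exist _ S0 CS0))).
apply: x2; apply: (span_sub (chS b) hb); apply: s2.
by exists b.+1.
Qed.

End FiniteGeneration.

(** * Local rings *)

Section Local.
Variable R : comNzRingType.
Hypothesis hR : noetherian R.
Variable m : {pred R}.
Hypothesis hm : local_ring m.
Implicit Types (K L M N : lmodType R).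

Lemma noeth_ring : noeth_module R^o.
Proof. exact: noeth_fin_gen (fin_gen_regular R). Qed.

Lemma m_ideal : idealr_closed m. Proof. by case: hm => [[]]. Qed.

Lemma m_submod : is_submod (fun x : R^o => x \in m).
Proof. by case: m_ideal => h0 _ h; split=> // a x y hx hy; apply: h. Qed.

Lemma m_one : 1 \notin m. Proof. by case: m_ideal. Qed.

Lemma mem_m_mull a b : b \in m -> a * b \in m.
Proof. exact: (submodZ (M := R^o) a m_submod). Qed.

Lemma mem_m_mulr a b : a \in m -> a * b \in m.
Proof. by rewrite mulrC; apply: mem_m_mull. Qed.

Lemma mem_mD a b : a \in m -> b \in m -> a + b \in m.
Proof. exact: (submodD (M := R^o) m_submod). Qed.

Lemma mem_mB a b : a \in m -> b \in m -> a - b \in m.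
Proof. exact: (submodB (M := R^o) m_submod). Qed.

Lemma mem_m_sum (I : finType) (F : I -> R) : (forall i, F i \in m) -> \sum_i F i \in m.
Proof.
by move=> h; apply: (big_ind (fun a => a \in m)) => //; [case: m_submod | apply: mem_mD].
Qed.

Lemma proper_in_m (I : R^o -> Prop) : is_submod I -> ~ I 1 -> forall a, I a -> a \in m.
Proof.
move=> hI I1 a Ia.
pose C (S : R^o -> Prop) := [/\ is_submod S, ~ S 1 & S a].
have [S [[S1 S2 S3] Smax]] : exists S, C S /\ forall T, C T ->
    (forall x, S x -> T x) -> forall x, T x -> S x.
  apply: noeth_maximal; first exact: noeth_ring.
    by move=> S [].
  by exists I; split.
pose p : {pred R} := fun x => `[<S x>].
have hp : maximal_ideal p.
  split.
    split; first by apply/asboolP; case: S1.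
      by apply/asboolP.
    move=> b x y /asboolP hx /asboolP hy; apply/asboolP.
    by case: S1 => _; apply.
  move=> J [J0 J1 JD] pJ x Jx; apply/asboolP.
  apply: (Smax (fun x => x \in J)) => //; last by move=> y Sy; apply: pJ; apply/asboolP.
  split.
  - by split=> // b u v hu hv; apply: JD.
  - exact/negP.
  - by apply: pJ; apply/asboolP.
by case: hm => _ /(_ p hp) <-; apply/asboolP.
Qed.

Lemma local_unit a : a \notin m -> exists b, b * a = 1.
Proof.
move=> ha; apply: contrapT => h; move/negP: ha; apply.
apply: (@proper_in_m (fun x => exists b, b * a = x)) => //; last by exists 1; rewrite mul1r.
split; first by exists 0; rewrite mul0r.
by move=> r _ _ [b <-] [c <-]; exists (r * b + c); rewrite mulrDl -mulrA.
Qed.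

Lemma unit_sub1 a : a \in m -> exists b, b * (1 - a) = 1.
Proof.
move=> ha; apply: local_unit; apply/negP => h; move/negP: m_one; apply.
by rewrite -(subrK a 1); apply: mem_mD.
Qed.

Lemma m_gens : exists z : seq R^o,
  {subset z <= m} /\ forall a, a \in m -> lin_span z a.
Proof.
have [z [z1 z2]] := noeth_ring m_submod.
by exists z.
Qed.

(** Induction on the number of elements: modulo S + Rx the remaining elements
    satisfy the same hypothesis, so that all of them lie in S + Rx, and then
    (1 - c)x lies in S for some c in the maximal ideal. *)
Lemma nakayama_seq M (S : M -> Prop) (s : seq M) : is_submod S ->
  (forall x, x \in s -> exists c : nat -> R,
     (forall i, c i \in m) /\ S (x - \sum_(i < size s) c i *: s`_i)) ->
  forall x, x \in s -> S x.
Proof.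
elim: s S => // a s IH S hS h.
pose S' y := exists r, S (y - r *: a).
have hS' : is_submod S'.
  split; first by exists 0; rewrite scale0r subr0; case: hS.
  move=> b x y [r hr] [r' hr']; exists (b * r + r').
  rewrite scalerDl opprD addrACA -scalerA -scalerBr.
  by case: hS => _; apply.
have hs : forall x, x \in s -> S' x.
  apply: IH => // x xs; have [c [c1 c2]] := h x (mem_behead (s := a :: s) xs).
  exists (fun i => c i.+1); split=> //; exists (c 0%N).
  by move: c2; rewrite big_ord_recl /= opprD addrCA [- _ + _]addrC.
have [t ht] : exists t : nat -> R, forall i, (i < size s)%N -> S (s`_i - t i *: a).
  have h' i : exists r, (i < size s)%N -> S (s`_i - r *: a).
    case: (ltnP i (size s)) => hi; last by exists 0.
    by have [r hr] := hs s`_i (mem_nth 0 hi); exists r.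
  by exists (fun i => projT1 (cid (h' i))) => i; case: cid.
have Sa : S a.
  have [|c [c1]] := h a; first by rewrite inE eqxx.
  rewrite big_ord_recl /= => c2.
  pose d := c 0%N + \sum_(i < size s) c i.+1 * t i.
  have [|b hb] := @unit_sub1 d.
    apply: mem_mD => //.
    by apply: mem_m_sum => i; apply: mem_m_mulr.
  rewrite -[a]scale1r -hb -scalerA; apply: submodZ => //.
  rewrite scalerBl scale1r scalerDl scaler_suml.
  rewrite (_ : a - _ = (a - (c 0%N *: a + \sum_(i < size s) c (bump 0 i) *: s`_i))
     + \sum_(i < size s) c i.+1 *: (s`_i - t i *: a)); last first.
    under [X in _ = _ + X]eq_bigr => i _ do rewrite scalerBr.
    rewrite sumrB !opprD !addrA; congr (_ - _); last first.
      by apply: eq_bigr => i _; rewrite scalerA.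
    by rewrite subrK.
  by apply: submodD => //; apply: submod_sum => // i; apply: submodZ => //; apply: ht.
move=> x; rewrite inE => /orP [/eqP -> // | /hs [r hr]].
rewrite -(subrK (r *: a) x); apply: submodD => //; exact: submodZ.
Qed.

Lemma nakayama M (S : M -> Prop) (z : seq R) : fin_gen M -> is_submod S ->
  {subset z <= m} ->
  (forall x, exists y, in_ideal_mul z y /\ S (x - y)) -> forall x, S x.
Proof.
move=> [s hs] hS hz h x; apply: (span_sub hS _ (hs x)).
apply: nakayama_seq => // y _; have [w [[u ->] hw]] := h y.
have [d hd] : exists d : nat -> nat -> R,
    forall i, u i = \sum_(j < size s) d i j *: s`_j.
  by exists (fun i => projT1 (cid (hs (u i)))) => i; case: cid.
exists (fun j => \sum_(i < size z) z`_i * d i j); split=> [j|].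
  apply: mem_m_sum => i.
  by apply: mem_m_mulr; apply: hz; apply: mem_nth.
rewrite (_ : \sum_(j < size s) _ = \sum_(i < size z) z`_i *: u i) //.
under eq_bigr => j _ do rewrite scaler_suml.
rewrite exchange_big /=; apply: eq_bigr => i _; rewrite hd scaler_sumr.
by apply: eq_bigr => j _; rewrite scalerA.
Qed.

(** In a generating family of least size, a relation with a unit coefficient would
    make one of the generators redundant. *)
Lemma minimal_generators M : fin_gen M -> exists n (x : 'I_n -> M),
  onto (comb x) /\ forall v, comb x v = 0 -> forall i, v 0 i \in m.
Proof.
move=> /fin_genP hM.
have [n /asboolP [x hx] hmin] := ex_minnP
  (P := fun n => `[<exists x : 'I_n -> M, onto (comb x)>])
  (let: ex_intro n h := hM in ex_intro _ n (introT (asboolP _) h)).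
exists n, x; split=> // v hv i; apply/negPn/negP => /local_unit [b hb].
case: n x hx hmin v hv i hb => [|n] x hx hmin v hv i hb; first by case: i hb.
suff : (n.+1 <= n)%N by rewrite ltnn.
apply: hmin; apply/asboolP; exists (fun j => x (lift i j)) => y.
have [w <-] := hx y; exists (\row_j (w 0 (lift i j) - w 0 i * b * v 0 (lift i j))).
have -> : comb x w = comb x (w - (w 0 i * b) *: v).
  by rewrite [RHS]linearB linearZ hv /= scaler0 subr0.
rewrite /= [RHS](bigD1_ord i) //= !mxE -mulrA hb mulr1 subrr scale0r add0r.
by apply: eq_bigr => j _; rewrite !mxE.
Qed.

End Local.

(** * Projective modules, duals and left approximations *)

Section Projectives.
Variable R : comNzRingType.
Implicit Types (K L M N P : lmodType R).

Lemma row_coord_linear n (j : 'I_n) : linear (fun v : 'rV[R]_n => v 0 j : R^o).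
Proof. by move=> a u v; rewrite !mxE. Qed.

Definition row_coord n (j : 'I_n) : {linear 'rV[R]_n -> R^o} :=
  mk_linear (row_coord_linear j).

Lemma row_map_linear M n (f : 'I_n -> {linear M -> R^o}) :
  linear (fun x => \row_j f j x : 'rV[R]_n).
Proof. by move=> a x y; apply/rowP => j; rewrite !mxE linearP. Qed.

Definition row_map M n (f : 'I_n -> {linear M -> R^o}) : {linear M -> 'rV[R]_n} :=
  mk_linear (row_map_linear f).

Lemma scale_vec_linear M (x : M) : linear (fun a : R^o => (a : R) *: x).
Proof. by move=> a b c; rewrite scalerDl scalerA. Qed.

Definition scale_vec M (x : M) : {linear R^o -> M} := mk_linear (scale_vec_linear x).

Lemma projective_free n : projective ('rV[R]_n).
Proof.
move=> M N g h hg; pose s y := projT1 (cid (hg y)).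
have gs y : g (s y) = y by rewrite /s; case: cid.
exists (comb (fun i => s (h (delta_mx 0 i)))) => v.
rewrite /= linear_sum (linear_rowE h); apply: eq_bigr => i _.
by rewrite linearZ gs.
Qed.

Lemma fg_projective_free n : fg_projective ('rV[R]_n).
Proof. by split; [apply: fin_gen_free | apply: projective_free]. Qed.

Lemma projective_split M P (g : {linear M -> P}) : projective P -> onto g ->
  exists s : {linear P -> M}, cancel s g.
Proof. by move=> hP hg; apply: (hP _ _ g (idfun : {linear P -> P}) hg). Qed.

Lemma fg_projective_retract P : fg_projective P ->
  exists n (a : {linear P -> 'rV[R]_n}) (b : {linear 'rV[R]_n -> P}), cancel a b.
Proof.
move=> [/fin_genP [n [x hx]] hP].
have [a ha] := projective_split hP hx.
by exists n, a, (comb x).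
Qed.

Lemma retract_summand M N (i : {linear M -> N}) (p : {linear N -> M}) :
  cancel i p -> summand M N.
Proof.
move=> ip; have hp : onto p by move=> x; exists (i x).
have [K [j [hj jp _]]] := kernel_exists hp.
have [x|r hr] := factor_inj (g := (idfun \- (i \o p)) : {linear N -> N}) hj.
  by apply/jp; rewrite /= linearB ip subrr.
exists K.
have fl : linear (fun x => (p x, r x) : (M * K)%type).
  by move=> a x y; rewrite !linearP.
apply: (@iso_of _ _ _ (mk_linear fl)).
  apply/injP => x /= [px rx].
  by have := hr x; rewrite rx linear0 /= px linear0 subr0.
move=> [y z]; exists (i y + j z) => /=.
have e : p (i y + j z) = y by rewrite linearD ip (exact_comp0 _ jp) addr0.
congr pair => //; apply: hj; rewrite hr /= e addrC addKr.
by [].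
Qed.

Lemma mem_dual_sum M n (x : 'I_n -> dual M) v y :
  (comb x v : {linear M -> R^o}) y = \sum_i v 0 i * (x i : {linear M -> R^o}) y.
Proof.
rewrite /=.
have hl : linear (fun f : dual M => (f : {linear M -> R^o}) y) by [].
rewrite -[LHS]/(mk_linear hl _) linear_sum.
by apply: eq_bigr => i _; rewrite linearZ.
Qed.

Lemma fin_gen_dual M : noetherian R -> fin_gen M -> fin_gen (dual M).
Proof.
move=> hR /fin_genP [n [x hx]].
have hl : linear (fun f : dual M => \row_j (f : {linear M -> R^o}) (x j) : 'rV[R]_n).
  by move=> a f g; apply/rowP => j; rewrite !mxE.
apply: (@fin_gen_inj _ _ _ (mk_linear hl) hR _ (fin_gen_free R n)).
apply/injP => f /rowP hf; apply: homP => y; have [v <-] := hx y.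
rewrite linear_sum big1 // => i _; rewrite linearZ /=.
by have := hf i; rewrite !mxE => ->; rewrite scaler0.
Qed.

End Projectives.

Arguments fg_projective_free {R}.
Arguments row_coord {R n}.

Section LocalApproximations.
Variable R : comNzRingType.
Hypothesis hR : noetherian R.
Variable m : {pred R}.
Hypothesis hm : local_ring m.
Implicit Types (K L M N : lmodType R).

(** A matrix that is the identity modulo the maximal ideal has determinant 1
    modulo the maximal ideal. *)
Lemma unit_matrix n (A : 'M[R]_n) :
  (forall i j, A i j - (1%:M : 'M[R]_n) i j \in m) ->
  exists B : 'M[R]_n, A *m B = 1%:M /\ B *m A = 1%:M.
Proof.
move=> hA; have hS := m_submod hm.
have hd : \det A - 1 \in m.
  rewrite -(det1 R n) /determinant -sumrB.
  apply: (mem_m_sum hm) => s; rewrite -mulrBr; apply: mem_m_mull => //.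
  apply: (big_ind2 (fun a b => a - b \in m)) => //.
    by rewrite subrr; case: hS.
  move=> a b c d hab hcd; rewrite (_ : _ - _ = (a - b) * c + b * (c - d)).
    by apply: (mem_mD hm); [apply: (mem_m_mulr hm) | apply: (mem_m_mull hm)].
  by rewrite mulrBl mulrBr addrA subrK.
have [|b hb] := @local_unit _ hR _ hm (\det A).
  apply/negP => h; move/negP: (m_one hm); apply.
  have := mem_mB hm h hd.
  by rewrite opprB addrC subrK.
exists (b *: \adj A); rewrite -scalemxAr mul_mx_adj -scalemxAl mul_adj_mx.
by rewrite scale_scalar_mx hb.
Qed.

(** The coordinates of f are minimal generators of M*. If gf = f, the rows of the
    matrix of g - 1 are relations between them, so that g is the identity modulo
    the maximal ideal. *)
Lemma minimal_approx_exists M : fin_gen M ->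
  exists n (f : {linear M -> 'rV[R]_n}), minimal_left_approx f.
Proof.
move=> hM; have [n [x [hx xm]]] := minimal_generators hR hm (fin_gen_dual hR hM).
pose f := row_map (fun j => x j : {linear M -> R^o}).
exists n, f; split; first split; first exact: fg_projective_free.
  move=> Q /fg_projective_retract [k [a [b ab]]] h.
  pose w (j : 'I_k) : dual M := (row_coord j \o (a \o h) : {linear M -> R^o}).
  pose v j := projT1 (cid (hx (w j))).
  have hv j : comb x (v j) = w j by rewrite /v; case: cid.
  exists (b \o (row_map (fun j => comb (fun i => v j 0 i : R^o)))) => y /=.
  rewrite -[RHS]ab; congr (b _); apply/rowP => j; rewrite !mxE.
  have -> : a (h y) 0 j = (w j : {linear M -> R^o}) y by [].
  rewrite -(hv j) mem_dual_sum; apply: eq_bigr => i _.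
  by rewrite !mxE mulrC.
move=> g hg.
have [|B [AB BA]] := @unit_matrix n (lin1_mx g).
  move=> i j.
  pose u : 'rV[R]_n := \row_i (lin1_mx g i j - (1%:M : 'M[R]_n) i j).
  have -> : lin1_mx g i j - (1%:M : 'M[R]_n) i j = u 0 i by rewrite [RHS]mxE.
  apply: xm; apply: homP => y; rewrite mem_dual_sum /=.
  have /rowP/(_ j) := hg y; rewrite -mul_rV_lin1 mxE => /eqP.
  rewrite -subr_eq0 => /eqP e; rewrite -[RHS]e.
  rewrite -[X in _ - fun_of_matrix X _ _](mulmx1 (f y)) [X in _ - X]mxE -sumrB.
  apply: eq_bigr => i' _.
  by rewrite !mxE -mulrBr mulrC.
exists (fun v => v *m B) => v; rewrite -mul_rV_lin1.
  by rewrite -mulmxA AB mulmx1.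
by rewrite -mulmxA BA mulmx1.
Qed.

End LocalApproximations.

Definition torsionless (R : comNzRingType) (M : lmodType R) : Prop :=
  forall x : M, (forall f : {linear M -> R^o}, f x = 0) -> x = 0.

Lemma torsionless_inj (R : comNzRingType) (M N : lmodType R) (i : {linear M -> N}) :
  injective i -> torsionless N -> torsionless M.
Proof.
move=> /injP hi hN x hx; apply: hi; apply: hN => f.
exact: (hx (f \o i)).
Qed.

Lemma torsionless_free (R : comNzRingType) n : torsionless 'rV[R]_n.
Proof. by move=> v hv; apply/rowP => j; rewrite mxE; apply: (hv (row_coord j)). Qed.

Section Cosyzygies.
Variable R : comNzRingType.
Hypothesis hR : noetherian R.
Variable m : {pred R}.
Hypothesis hm : local_ring m.
Variable X : subcat R.
Hypothesis hX : resolving X.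
Hypothesis hcosyz : closed_under_cosyzygies X.
Implicit Types (K L M N : lmodType R).

Lemma free_mem n : X 'rV[R]_n.
Proof. by apply: (resolving_proj hX); apply: fg_projective_free. Qed.

Lemma cosyzygy_mem M : X M ->
  exists n (f : {linear M -> 'rV[R]_n}) (C : lmodType R) (q : {linear 'rV[R]_n -> C}),
  [/\ exact_at f q, onto q, X C &
      forall h : {linear M -> R^o}, exists g : {linear 'rV[R]_n -> R^o},
        forall x, g (f x) = h x].
Proof.
move=> XM; have [n [f hf]] := minimal_approx_exists hR hm (resolving_fg hX XM).
have [C [q [hq qf]]] := quotient_exists (im_submod f).
exists n, f, C, q; split=> //.
  by apply: hcosyz XM; exists 'rV[R]_n, f, q; split.
move=> h; case: hf => [[_ hf] _].
have [g hg] := hf _ (fg_projective_free 1) (row_map (fun=> h)).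
exists (row_coord 0 \o g) => x; rewrite /= hg.
by rewrite mxE.
Qed.

(** The kernel of the biduality map of M is the kernel of a left approximation
    f of M, and the image of f is the kernel of the projection onto the
    cosyzygy. *)
Lemma torsion_sequence M : X M ->
  exists (H I : lmodType R) (j : {linear H -> M}) (p : {linear M -> I}),
  [/\ short_exact j p, X H, X I, torsionless I &
      forall (f : {linear M -> R^o}) h, f (j h) = 0].
Proof.
move=> XM; have [n [f [C [q [qf hq XC hf]]]]] := cosyzygy_mem XM.
have [I [i hi]] := kernel_exists hq.
have [i1 i2 _] := hi.
have [p hp] : exists p : {linear M -> I}, forall x, i (p x) = f x.
  by apply: factor_inj => // x; apply/i2/qf; exists x.
have po : onto p.
  move=> y; have /qf [x hx] : q (i y) = 0 by apply: exact_comp0.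
  by exists x; apply: i1; rewrite hp.
have [H [j hj]] := kernel_exists po.
have XI : X I by apply: (resolving_ker hX hi _ XC); apply: free_mem.
exists H, I, j, p; split=> //.
- exact: (resolving_ker hX hj XM XI).
- by apply: torsionless_inj i1 _; apply: torsionless_free.
move=> h y; have [g <-] := hf h.
by rewrite -hp; case: hj => _ jp _; rewrite (exact_comp0 _ jp) !linear0.
Qed.

Variables (k : lmodType R).
Hypothesis hk : residue_field m k.

(** The first element of a minimal system of generators of N spans a copy of k,
    and its coordinate modulo m is a retraction. *)
Lemma residue_field_mem N : X N -> (forall a (x : N), a \in m -> a *: x = 0) ->
  ~ zero_module N -> X k.
Proof.
move=> XN mN N0; have [q [hq qm]] := hk.
have [[|n] [x [hx xm]]] := minimal_generators hR hm (resolving_fg hX XN).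
  by case: N0 => y; have [v <-] := hx y; rewrite /= big_ord0.
have [rho hrho] : exists rho : {linear N -> k},
    forall v, rho (comb x v) = (q \o row_coord 0) v.
  by apply: factor_onto => // v hv; apply/qm; apply: xm.
have [sg hsg] : exists sg : {linear k -> N}, forall a, sg (q a) = scale_vec (x 0) a.
  by apply: factor_onto => // a /qm ha; apply: mN.
apply: (resolving_summand hX _ XN); apply: (@retract_summand _ _ _ sg rho) => y.
have [a <-] := hq y; rewrite hsg /= linearZ -[x 0](comb_delta x 0) hrho /=.
by rewrite -linearZ /= mxE !eqxx; congr (q _); apply: mulr1.
Qed.

End Cosyzygies.

(** * Regular sequences on syzygies *)

Section RegularSequences.
Variable R : comNzRingType.
Implicit Types (K L M N A F B : lmodType R) (s : seq R).

Lemma ideal_mul_submod M s : is_submod (@in_ideal_mul R M s).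
Proof.
split=> [|a _ _ [c ->] [d ->]].
  by exists (fun=> 0); rewrite big1 // => i _; rewrite scaler0.
exists (fun i => a *: c i + d i); rewrite scaler_sumr -big_split /=.
by apply: eq_bigr => i _; rewrite scalerDr !scalerA mulrC.
Qed.

Lemma ideal_mul_nil M (x : M) : in_ideal_mul [::] x -> x = 0.
Proof. by case=> c ->; rewrite big_ord0. Qed.

Lemma ideal_mul_rcons M s a (x : M) :
  in_ideal_mul (rcons s a) x <-> exists y u, in_ideal_mul s y /\ x = y + a *: u.
Proof.
split=> [[c ->] | [_ [u [[c ->] ->]]]].
  rewrite size_rcons big_ord_recr /= nth_rcons ltnn eqxx.
  do 2!eexists; split; last by [].
  by exists c; apply: eq_bigr => i _; rewrite nth_rcons ltn_ord.
exists (fun i => if (i < size s)%N then c i else u).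
rewrite size_rcons big_ord_recr /= nth_rcons ltnn eqxx.
by congr (_ + _); apply: eq_bigr => i _; rewrite nth_rcons ltn_ord.
Qed.

Lemma ideal_mul_linear M N (f : {linear M -> N}) s x :
  in_ideal_mul s x -> in_ideal_mul s (f x).
Proof.
case=> c ->; exists (f \o c); rewrite linear_sum.
by apply: eq_bigr => i _; rewrite linearZ.
Qed.

Lemma ideal_mul_lift M N (p : {linear M -> N}) s y : onto p -> in_ideal_mul s y ->
  exists x, in_ideal_mul s x /\ p x = y.
Proof.
move=> hp [c ->]; pose d i := projT1 (cid (hp (c i))).
have pd i : p (d i) = c i by rewrite /d; case: cid.
exists (\sum_(i < size s) s`_i *: d i); split; first by exists d.
by rewrite linear_sum; apply: eq_bigr => i _; rewrite linearZ pd.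
Qed.

Lemma ideal_mul_mem M s a (x : M) : a \in s -> in_ideal_mul s (a *: x).
Proof.
move=> /(nthP 0) [j hj <-]; exists (fun i => if i == j then x else 0).
rewrite (bigD1 (Ordinal hj)) //= eqxx big1 ?addr0 // => i ij.
by rewrite ifN ?scaler0 //; apply: contra ij => /eqP e; apply/eqP/val_inj.
Qed.

Lemma ideal_mul_scale M s (a : R^o) (x : M) :
  in_ideal_mul s a -> in_ideal_mul s ((a : R) *: x).
Proof. exact: (ideal_mul_linear (scale_vec x)). Qed.

Lemma ideal_mul_row n s (v : 'rV[R]_n) :
  in_ideal_mul s v <-> forall j, in_ideal_mul s (v 0 j : R^o).
Proof.
split=> [h j | h]; first exact: (ideal_mul_linear (row_coord j) h).
rewrite (row_sum_delta v); apply: submod_sum => [|j]; first exact: ideal_mul_submod.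
exact: ideal_mul_scale.
Qed.

Definition weakly_regular M s : Prop :=
  forall i, (i < size s)%N -> forall x : M,
     in_ideal_mul (take i s) (s`_i *: x) -> in_ideal_mul (take i s) x.

Lemma weakly_regular_take M s i : weakly_regular M s -> weakly_regular M (take i s).
Proof.
move=> h j hj x; rewrite size_take_min ltn_min in hj; case/andP: hj => ji js.
by rewrite nth_take // take_takel ?(ltnW ji) //; apply: h.
Qed.

Lemma weakly_regular_rcons M s a : weakly_regular M (rcons s a) <->
  weakly_regular M s /\ forall x : M, in_ideal_mul s (a *: x) -> in_ideal_mul s x.
Proof.
split=> [h | [h1 h2] i].
  split=> [|x].
    by rewrite -(take_size_cat [:: a] (erefl (size s))) cats1; apply: weakly_regular_take.
  have := h (size s); rewrite size_rcons ltnSn => /(_ isT x).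
  by rewrite nth_rcons ltnn eqxx -cats1 take_size_cat.
rewrite size_rcons ltnS leq_eqVlt => /orP [/eqP -> | hi] x.
  by rewrite nth_rcons ltnn eqxx -cats1 take_size_cat //; apply: h2.
rewrite nth_rcons hi -cats1 takel_cat ?(ltnW hi) //; exact: h1.
Qed.

(** If i(x) = y + au with y in (s)F, then a annihilates the image of u modulo (s)B,
    so u can be corrected by an element of (s)F to lie in the image of A. *)
Lemma ideal_mul_sub A F B (i : {linear A -> F}) (p : {linear F -> B}) s x :
  short_exact i p -> weakly_regular B s ->
  in_ideal_mul s (i x) -> in_ideal_mul s x.
Proof.
move=> [i1 ip p1]; elim/last_ind: s x => [|s a IH] x.
  move=> _ /ideal_mul_nil e; have -> : x = 0 by apply: i1; rewrite e linear0.
  by case: (ideal_mul_submod A [::]).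
move=> /weakly_regular_rcons [hs ha] /ideal_mul_rcons [y [u [ys e]]].
have hu : in_ideal_mul s (p u).
  apply: ha; have := exact_comp0 x ip; rewrite e linearD linearZ /= => /eqP.
  rewrite addrC addr_eq0 => /eqP ->; apply: submodN; first exact: ideal_mul_submod.
  exact: ideal_mul_linear.
have [u' [su' pu']] := ideal_mul_lift p1 hu.
have /ip [w iw] : p (u - u') = 0 by rewrite linearB pu' subrr.
apply/ideal_mul_rcons; exists (x - a *: w), w; split; last by rewrite subrK.
apply: IH => //; rewrite linearB linearZ iw e /= scalerBr opprB.
rewrite [_ *: u' - _]addrC addrA addrK.
apply: submodD => //; first exact: ideal_mul_submod.
by apply: submodZ => //; apply: ideal_mul_submod.
Qed.

Lemma weakly_regular_sub A F B (i : {linear A -> F}) (p : {linear F -> B}) s :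
  short_exact i p -> weakly_regular F s ->
  (forall j, (j < size s)%N -> weakly_regular B (take j s)) -> weakly_regular A s.
Proof.
move=> hip hF hB j hj x hx; apply: (ideal_mul_sub hip (hB j hj)).
by apply: hF => //; rewrite -linearZ; apply: ideal_mul_linear.
Qed.

Lemma weakly_regular_free n s : weakly_regular R^o s -> weakly_regular 'rV[R]_n s.
Proof.
move=> h i hi v /ideal_mul_row hv; apply/ideal_mul_row => j; apply: h => //.
by have := hv j; rewrite mxE.
Qed.

Fixpoint is_nth_syzygy (n : nat) A : Prop :=
  if n is n'.+1 then
    exists k B (i : {linear A -> 'rV[R]_k}) (p : {linear 'rV[R]_k -> B}),
      short_exact i p /\ is_nth_syzygy n' B
  else True.

Lemma weakly_regular_syzygy n A s : is_nth_syzygy n A -> (size s <= n)%N ->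
  weakly_regular R^o s -> weakly_regular A s.
Proof.
elim: n A s => [|n IH] A s /=.
  by rewrite leqn0 size_eq0 => _ /eqP -> _ i.
move=> [k [B [i [p [hip hB]]]]] hs hR.
apply: (weakly_regular_sub hip); first exact: weakly_regular_free.
move=> j hj; apply: IH => //; last exact: weakly_regular_take.
by rewrite size_take hj -ltnS (leq_trans hj).
Qed.

End RegularSequences.

(** * The socle modulo a maximal regular sequence *)

Section Depth.
Variable R : comNzRingType.
Hypothesis hR : noetherian R.
Variable m : {pred R}.
Hypothesis hm : local_ring m.
Implicit Types (A F B M N : lmodType R) (s : seq R).

Lemma finite_subspan M (P : M -> Prop) : noeth_module M ->
  exists s : seq M, (forall x, x \in s -> P x) /\ forall x, P x -> lin_span s x.
Proof.
move=> hM.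
have [||T [[s [s1 ->]] s2]] := @noeth_maximal _ _
    (fun T => exists s : seq M, (forall x, x \in s -> P x) /\ T = lin_span s) hM.
- by move=> _ [s [_ ->]]; apply: span_submod.
- by exists (lin_span [::]), [::].
exists s; split=> // x Px; apply: (s2 (lin_span (x :: s))).
- exists (x :: s); split=> // y; rewrite inE => /orP [/eqP -> // |]; exact: s1.
- by move=> y; apply: span_sub (span_submod _) _ => z zs; apply: span_mem; rewrite inE zs orbT.
- by apply: span_mem; rewrite inE eqxx.
Qed.

Section AssociatedPrimes.
Variables (S : R^o -> Prop) (hS : is_submod S).

Let ann (y a : R) := S (a * y).

Let ann_submod y : is_submod (ann y : R^o -> Prop).
Proof.
split; first by rewrite /ann mul0r; case: hS.
by move=> a b c hb hc; rewrite /ann mulrDl -mulrA; case: hS => _; apply.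
Qed.

(* Every zero divisor modulo S lies in such a maximal annihilator (S : y), and
   these are prime. *)
Let max_ann y := ~ S y /\ forall y', ~ S y' -> (forall a, ann y a -> ann y' a) ->
  forall a, ann y' a -> ann y a.

Let max_ann_prime y a b : max_ann y -> ann y (a * b) -> ~ ann y b -> ann y a.
Proof.
move=> [Sy hy] hab hb; apply: (hy (b * y)) => //; last by rewrite /ann mulrA.
by move=> c hc; rewrite /ann mulrCA; apply: (submodZ (M := R^o)).
Qed.

Let max_ann_exists y : ~ S y -> exists y', max_ann y' /\ forall a, ann y a -> ann y' a.
Proof.
move=> Sy.
have [||T [[y' [Sy' -> yy']] Tmax]] := @noeth_maximal _ R^o
   (fun T => exists y', [/\ ~ S y', T = ann y' & forall a, ann y a -> ann y' a]) (noeth_ring hR).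
- by move=> _ [y' [_ -> _]]; apply: ann_submod.
- by exists (ann y), y; split.
exists y'; split=> //; split=> // y'' Sy'' h; apply: Tmax => //.
by exists y''; split=> // a /yy' /h.
Qed.

Let not_ann1 y : max_ann y -> ~ ann y 1.
Proof. by move=> [Sy _]; rewrite /ann mul1r. Qed.

(* Prime avoidance: an element of m outside the primes already treated can be
   corrected by an element of m that lies in all of these and not in the new one,
   because distinct maximal annihilators are incomparable. *)
Let avoidance (l : seq R) : (forall y, y \in l -> max_ann y) ->
  (forall y, y \in l -> exists2 c, c \in m & ~ ann y c) ->
  exists2 a, a \in m & forall y, y \in l -> ~ ann y a.
Proof.
elim: l => [|y l IH] h1 h2; first by exists 0; rewrite // ; case: (m_submod hm).
have yl z : z \in l -> z \in y :: l by rewrite inE => ->; rewrite orbT.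
have [a am ha] := IH (fun z zl => h1 z (yl z zl)) (fun z zl => h2 z (yl z zl)).
have hy : max_ann y by apply: h1; rewrite inE eqxx.
have [ya | nya] := pselect (ann y a); last first.
  by exists a => // z; rewrite inE => /orP [/eqP -> | /ha].
have [c cm hc] : exists2 c, c \in m & ~ ann y c by apply: h2; rewrite inE eqxx.
have [d hd dl] : exists2 d, ~ ann y d & forall z, z \in l -> ann z d.
  elim: l ha h1 {IH h2 yl} => [|z l IH] ha h1.
    by exists 1 => //; apply: not_ann1.
  have [||d hd dl] := IH.
  - by move=> w wl; apply: ha; rewrite inE wl orbT.
  - move=> w; rewrite inE => /orP [/eqP -> // | wl].
    by apply: h1; rewrite !inE wl !orbT.
  have hz : max_ann z by apply: h1; rewrite !inE eqxx orbT.
  have [e ze ye] : exists2 e, ann z e & ~ ann y e.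
    apply: contrapT => hno; apply: (ha z); first by rewrite inE eqxx.
    case: hz => _ hz; apply: (hz y) => //; first by case: hy.
    by move=> e ze; apply: contrapT => ye; apply: hno; exists e.
  exists (d * e) => [h | w]; first exact/hd/(max_ann_prime hy h).
  rewrite inE => /orP [/eqP -> | wl].
    exact: (submodZ (M := R^o) d (ann_submod z)).
  by rewrite mulrC; apply: (submodZ (M := R^o) e (ann_submod w)); apply: dl.
exists (a + c * d) => [|z].
  by apply: (mem_mD hm) => //; apply: mem_m_mulr.
rewrite inE => /orP [/eqP -> | zl] h.
  apply: hc; apply: (max_ann_prime hy _ hd).
  by rewrite -[c * d](addKr a) addrC; apply: (submodB (M := R^o) (ann_submod y)).
apply: (ha z zl); rewrite -[a](addrK (c * d)).
apply: (submodB (M := R^o) (ann_submod z)) => //.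
exact: (submodZ (M := R^o) c (ann_submod z) (dl z zl)).
Qed.

(** If m consists of zero divisors modulo S, it is covered by the maximal
    annihilators (S : y). Finitely many of them suffice, because the elements y span
    a finitely generated submodule, so that m is one of them by prime avoidance. *)
Lemma zero_divisors_socle :
  (forall a, a \in m -> exists2 y, ~ S y & S (a * y)) ->
  exists2 y, ~ S y & forall a, a \in m -> S (a * y).
Proof.
move=> hz; apply: contrapT => hno.
have [s [s1 s2]] := finite_subspan max_ann (noeth_ring hR).
have [a am ha] : exists2 a, a \in m & forall y, y \in s -> ~ ann y a.
  apply: avoidance => // y /s1 [Sy _]; apply: contrapT => h; apply: hno.
  by exists y => // a am; apply: contrapT => ya; apply: h; exists a.
have [y0 Sy0 hy0] := hz a am.
have [y [hy y0y]] := max_ann_exists Sy0.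
(* Otherwise the product of elements of the other annihilators, none of them in
   (S : y), would annihilate the generators s and hence y. *)
have [z zs zy] : exists2 z, z \in s & forall b, ann z b -> ann y b.
  apply: contrapT => h.
  have [d hd ds] : exists2 d, ~ ann y d & forall z, z \in s -> ann z d.
    elim: s h {s1 s2 ha} => [|z s IH] h; first by exists 1 => //; apply: not_ann1.
    have [|d hd ds] := IH.
      by move=> [w ws hw]; apply: h; exists w => //; rewrite inE ws orbT.
    have [e ze ye] : exists2 e, ann z e & ~ ann y e.
      apply: contrapT => h'; apply: h; exists z; first by rewrite inE eqxx.
      by move=> e ze; apply: contrapT => ye; apply: h'; exists e.
    exists (d * e) => [h' | w]; first exact/hd/(max_ann_prime hy h').
    rewrite inE => /orP [/eqP -> | ws].
      exact: (submodZ (M := R^o) d (ann_submod z)).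
    by rewrite mulrC; apply: (submodZ (M := R^o) e (ann_submod w)); apply: ds.
  apply: hd; apply: (@span_sub _ R^o (fun x => S (d * x)) s) (s2 y hy) => //.
  split; first by rewrite mulr0; case: hS.
  move=> b u v hu hv; rewrite mulrDr; apply: (submodD (M := R^o)) => //.
  by rewrite [d * _]mulrCA; apply: (submodZ (M := R^o)).
have [_ hz'] := s1 z zs.
apply: (ha z zs); apply: (hz' y) => //; first by case: hy.
exact: y0y.
Qed.

End AssociatedPrimes.

Lemma ideal_mul_m s (x : R^o) : {subset s <= m} -> in_ideal_mul s x -> x \in m.
Proof.
move=> hs [c ->]; apply: (mem_m_sum hm) => i.
by apply: mem_m_mulr => //; apply: hs; apply: mem_nth.
Qed.

Lemma maximal_regular_sequence : exists s, [/\ {subset s <= m}, weakly_regular R^o s &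
  exists2 y : R^o, ~ in_ideal_mul s y & forall a, a \in m -> in_ideal_mul s (a * y : R^o)].
Proof.
have [||T [[s [sm hs ->]] smax]] := @noeth_maximal _ R^o (fun T => exists s,
  [/\ {subset s <= m}, weakly_regular R^o s & T = @in_ideal_mul _ R^o s]) (noeth_ring hR).
- by move=> _ [s [_ _ ->]]; apply: ideal_mul_submod.
- by exists (@in_ideal_mul _ R^o [::]), [::]; split.
exists s; split=> //.
apply: zero_divisors_socle; first exact: ideal_mul_submod.
move=> a am; apply: contrapT => h.
have ha x : in_ideal_mul s (a * x : R^o) -> in_ideal_mul s (x : R^o).
  by move=> hx; apply: contrapT => nx; apply: h; exists x.
have s1 : ~ in_ideal_mul s (1 : R^o).
  by move/(ideal_mul_m sm) => h1; move: (m_one hm); rewrite h1.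
apply: s1; apply: (ha); apply: (smax (@in_ideal_mul _ R^o (rcons s a))).
- exists (rcons s a); split=> //; last
    by apply/weakly_regular_rcons; split=> // x; apply: (ha).
  by move=> b; rewrite mem_rcons inE => /orP [/eqP -> | /sm].
- move=> x hx; apply/ideal_mul_rcons; exists x, 0; split=> //.
  by rewrite scaler0 addr0.
- by apply: ideal_mul_mem; rewrite mem_rcons inE eqxx.
Qed.

(** Suppose that F/A is an arbitrarily high syzygy and that e, a member of a basis
    of A in the sense that some functional takes the value 1 on it, lies in mF.
    Let y generate a socle element modulo a maximal regular sequence s. Then ye
    lies in (s)F, hence in (s)A since s is regular on F/A, and so y would be in
    (s). *)
Lemma no_infinite_coresolution A F B (i : {linear A -> F}) (p : {linear F -> B})
    (e : A) (lam : {linear A -> R^o}) (z : seq R) :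
  short_exact i p -> lam e = 1 -> {subset z <= m} -> in_ideal_mul z (i e) ->
  (forall n, is_nth_syzygy n B) -> False.
Proof.
move=> hip e1 zm [c he] hB.
have [s [sm hs [y sy hy]]] := maximal_regular_sequence.
apply: sy; rewrite -[y]mulr1 -[y * 1]/(y *: (1 : R^o)) -e1 -linearZ.
apply: ideal_mul_linear.
apply: (ideal_mul_sub hip (weakly_regular_syzygy (hB _) (leqnn (size s)) hs)).
rewrite linearZ he /= scaler_sumr; apply: submod_sum => [|j]; first exact: ideal_mul_submod.
rewrite scalerA mulrC; apply: ideal_mul_scale; apply: hy.
by apply: zm; apply: mem_nth.
Qed.

End Depth.

(** * Extension of functionals *)

Section Extensions.
Variable R : comNzRingType.
Implicit Types (A B E F G K L M N P : lmodType R) (z : seq R).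

(** The vanishing of Ext^1(N, R), stated for all extensions of N at once. *)
Definition ext1_zero N : Prop :=
  forall A B (i : {linear A -> B}) (p : {linear B -> N}), short_exact i p ->
  forall f : {linear A -> R^o}, exists g : {linear B -> R^o}, forall x, g (i x) = f x.

Lemma pair_map_linear A B N (f : {linear A -> N}) (g : {linear B -> N}) :
  linear (fun x : (A * B)%type => f x.1 + g x.2).
Proof. by move=> a x y; rewrite /= !linearP scalerDr addrACA. Qed.

Definition pair_map A B N (f : {linear A -> N}) (g : {linear B -> N}) :
  {linear (A * B)%type -> N} := mk_linear (pair_map_linear f g).

Lemma in_left_linear A B : linear (fun x : A => (x, 0) : (A * B)%type).
Proof. by move=> a x y; congr pair; rewrite /= scaler0 addr0. Qed.

Definition in_left A B : {linear A -> (A * B)%type} := mk_linear (@in_left_linear A B).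

Lemma in_right_linear A B : linear (fun x : B => (0, x) : (A * B)%type).
Proof. by move=> a x y; congr pair; rewrite /= scaler0 addr0. Qed.

Definition in_right A B : {linear B -> (A * B)%type} := mk_linear (@in_right_linear A B).

Lemma pairE A B (x : A) (y : B) : (x, y) = in_left A B x + in_right A B y.
Proof. by congr pair; rewrite /= ?addr0 ?add0r. Qed.

(** Any extension of N is a quotient of the direct sum of A and a projective
    module, so that it suffices to extend functionals in one presentation. *)
Lemma ext1_zero_presentation N L F (i : {linear L -> F}) (p : {linear F -> N}) :
  short_exact i p -> projective F ->
  (forall f : {linear L -> R^o}, exists g : {linear F -> R^o}, forall x, g (i x) = f x) ->
  ext1_zero N.
Proof.
move=> [i1 ip p1] hF hext A B j q [j1 jq q1] f.
have [t ht] := hF _ _ q p q1.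
have [x|u hu] := factor_inj (g := t \o i) j1.
  by apply/jq; rewrite /= ht (exact_comp0 _ ip).
have [g hg] := hext (f \o u).
have [||h hh] := @factor_onto _ _ _ _ (pair_map j t) (pair_map f g).
- move=> y; have [v pv] := p1 (q y).
  have /jq [x jx] : q (y - t v) = 0 by rewrite linearB ht pv subrr.
  by exists (x, v); rewrite /= jx subrK.
- move=> [x v] /= e.
  have /ip [l il] : p v = 0.
    have := congr1 q e; rewrite linearD linear0 ht.
    by rewrite (exact_comp0 _ jq) add0r.
  have : j (x + u l) = 0 by rewrite linearD hu /= il.
  by rewrite -il hg /= -linearD => /(injP j).1 -> //; rewrite linear0.
exists h => x; have := hh (x, 0); rewrite /= !linear0 !addr0.
by [].
Qed.

Lemma ffun_coord_linear L r (j : 'I_r) : linear (fun u : {ffun 'I_r -> L} => u j).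
Proof. by move=> a u v; rewrite !ffunE. Qed.

Definition ffun_coord L r (j : 'I_r) : {linear {ffun 'I_r -> L} -> L} :=
  mk_linear (ffun_coord_linear j).

Lemma ffun_single_linear L r (j : nat) :
  linear (fun l : L => [ffun t : 'I_r => if t == j :> nat then l else 0]).
Proof.
move=> a x y; apply/ffunP => t; rewrite !ffunE.
by case: ifP => // _; rewrite scaler0 addr0.
Qed.

Definition ffun_single L r (j : nat) : {linear L -> {ffun 'I_r -> L}} :=
  mk_linear (@ffun_single_linear L r j).

Lemma ffun_sum_single L r (u : {ffun 'I_r -> L}) : u = \sum_(j < r) ffun_single L r j (u j).
Proof.
apply/ffunP => t; rewrite sum_ffunE (bigD1 t) //= ffunE eqxx big1 ?addr0 // => j jt.
by rewrite ffunE ifN // eq_sym.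
Qed.

Lemma scaled_diag_linear L z :
  linear (fun l : L => [ffun j : 'I_(size z) => z`_j *: l]).
Proof.
move=> a x y; apply/ffunP => j.
by rewrite !ffunE scalerDr !scalerA mulrC.
Qed.

Definition scaled_diag L z : {linear L -> {ffun 'I_(size z) -> L}} :=
  mk_linear (@scaled_diag_linear L z).

Lemma scale_map_linear M (a : R) : linear (fun x : M => a *: x).
Proof. by move=> b x y; rewrite scalerDr !scalerA mulrC. Qed.

Definition scale_map M (a : R) : {linear M -> M} := mk_linear (@scale_map_linear M a).

(** The module PO is the pushout of F <- L -> A. *)
Lemma pushout_exists L F M A (i : {linear L -> F}) (p : {linear F -> M})
    (w : {linear L -> A}) : short_exact i p ->
  exists (PO : lmodType R) (q : {linear (A * F)%type -> PO})
      (a : {linear A -> PO}) (b : {linear PO -> M}),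
    [/\ onto q, forall x, q x = 0 <-> exists l, x = (w l, i l),
        short_exact a b, forall x, a x = q (x, 0) & forall x, b (q x) = p x.2].
Proof.
move=> [i1 ip p1].
have wl : linear (fun l => (w l, i l) : (A * F)%type).
  by move=> c x y; rewrite !linearP.
have [PO [q [q1 qE]]] := quotient_exists (im_submod (mk_linear wl)).
have qE' x : q x = 0 <-> exists l, x = (w l, i l).
  by rewrite qE; split=> [[l <-] | [l ->]]; exists l.
have [x /qE' [l ->]|b hb] := @factor_onto _ _ _ _ q (p \o snd) q1.
  by rewrite /= (exact_comp0 _ ip).
exists PO, q, (q \o in_left A F), b; split=> //.
split.
- apply/injP => x /qE' [l [-> il]].
  have -> : l = 0 by apply: i1; rewrite linear0.
  exact: linear0.
- move=> y; have [[x v] <-] := q1 y; rewrite hb /=; split=> [/ip [l il] | [x' e]].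
    exists (x - w l); apply/linear_eq_ker/qE'; exists (- l); rewrite !linearN il.
    by congr pair; rewrite /= ?sub0r // addrC addKr.
  rewrite -[v]/(snd (x, v)) -[p _]hb -e hb /=.
  exact: linear0.
- move=> y; have [v pv] := p1 y; exists (q (0, v)); rewrite hb.
  exact: pv.
Qed.

(** E is the pushout of F along L -> L^r, l |-> (z_j l)_j. Since (u, v) |-> u_j - z_j v
    is well defined on E with values in the free module F, a torsion element is the
    class of some (u, v) with u_j = z_j v for all j. Its product with z_j is then the
    class of (z_j u, u_j), which is the image of u_j under L -> L^r x F, so 0. *)
Section HomothetyPushout.
Variables (L M : lmodType R) (n : nat) (i : {linear L -> 'rV[R]_n}).
Variables (p : {linear 'rV[R]_n -> M}) (z : seq R).
Hypothesis hip : short_exact i p.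
Local Notation F := ('rV[R]_n).
Local Notation Lz := {ffun 'I_(size z) -> L}.
Variables (E : lmodType R) (q : {linear (Lz * F)%type -> E}).
Hypothesis q1 : onto q.
Hypothesis qE : forall x, q x = 0 <-> exists l, x = (scaled_diag L z l, i l).

Lemma pushout_torsionE h : (forall f : {linear E -> R^o}, f h = 0) ->
  exists u v, h = q (u, v) /\ forall j, i (u j) = z`_j *: v.
Proof.
move=> ht; have [[u v] e] := q1 h; exists u, v; split=> // j.
have [x /qE [l ->]|b hb] := @factor_onto _ _ _ _ q
  (pair_map (i \o ffun_coord L j) (scale_map F (- z`_j))) q1.
  by rewrite /= ffunE linearZ scaleNr subrr.
have : b h = 0 by apply: torsionless_free => f; apply: (ht (f \o b)).
by rewrite -e hb /= scaleNr => /subr0_eq.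
Qed.

Lemma pushout_torsion_killed h : (forall f : {linear E -> R^o}, f h = 0) ->
  forall a, lin_span (z : seq R^o) a -> (a : R) *: h = 0.
Proof.
move=> /pushout_torsionE [u [v [-> huv]]] a [c ->].
rewrite scaler_suml big1 // => j _; rewrite -[c j *: _]/(c j * z`_j) -scalerA.
have -> : z`_j *: q (u, v) = 0; last by rewrite scaler0.
rewrite -linearZ; apply/qE; exists (u j); congr pair; last by rewrite /= huv.
apply/ffunP => t; rewrite !ffunE; case: hip => i1 _ _; apply: i1.
by rewrite !linearZ !huv /= !scalerA mulrC.
Qed.

(** Pulling the extension of M with class f back to E gives an extension G of E
    by R. A functional on G with value c at the generator of R amounts to an
    expression of cf as the sum of an element of mL* and the restriction of a
    functional on F; moreover the entries of z occur among the values c. *)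
Lemma homothety_extension (f : {linear L -> R^o}) :
  exists (G : lmodType R) (e : {linear R^o -> G}) (b : {linear G -> E}),
  [/\ short_exact e b,
      forall lam : {linear G -> R^o}, exists (g : {linear F -> R^o}) (u : nat -> dual L),
        forall l, lam (e 1) * f l =
          g (i l) + \sum_(j < size z) z`_j * (u j : {linear L -> R^o}) l
    & forall j : 'I_(size z), exists lam : {linear G -> R^o}, lam (e 1) = z`_j].
Proof.
have wl : linear (fun l => (f l, scaled_diag L z l) : (R^o * Lz)%type).
  by move=> a x y; rewrite !linearP.
have [G [t [_ [_ [t1 tE _ _ _]]]]] := pushout_exists (mk_linear wl) hip.
case: (hip) => i1 _ _.
pose inR : {linear R^o -> ((R^o * Lz) * F)%type} :=
  in_left (R^o * Lz)%type F \o in_left R^o Lz.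
pose prE : {linear ((R^o * Lz) * F)%type -> E} :=
  q \o (pair_map (in_left Lz F \o snd) (in_right Lz F)).
have prEE c u v : prE ((c, u), v) = q (u, v) by rewrite /prE /= -pairE.
have [x /tE [l ->]|b hb] := @factor_onto _ _ _ _ t prE t1.
  by rewrite prEE; apply/qE; exists l.
exists G, (t \o inR), b; split.
- split.
  + apply/injP => c /tE [l [-> _ il]].
    by have -> : l = 0; [apply: i1; rewrite linear0 | rewrite linear0].
  + move=> y; have [[[c u] v] <-] := t1 y; rewrite hb prEE.
    split=> [/qE [l [-> ->]] | [c' e]].
      exists (c - f l); apply: (iffLR (linear_eq_ker t (inR (c - f l)) _)).
      apply/tE; exists (- l); rewrite !linearN.
      by congr pair; rewrite /= ?sub0r //; congr pair; rewrite /= ?sub0r // addrC addKr.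
    rewrite -(prEE c) -hb -e; apply: etrans (hb (inR c')) _.
    by apply: etrans (prEE c' 0 0) _; apply: linear0.
  + move=> y; have [[u v] <-] := q1 y; exists (t ((0, u), v)).
    by rewrite hb prEE.
- move=> lam.
  pose inL : {linear Lz -> G} := t \o (in_left (R^o * Lz)%type F \o in_right R^o Lz).
  pose inF : {linear F -> G} := t \o in_right (R^o * Lz)%type F.
  pose lR : {linear R^o -> R^o} := lam \o (t \o inR).
  pose lL : {linear Lz -> R^o} := lam \o inL.
  pose lF : {linear F -> R^o} := lam \o inF.
  exists (\- lF), (fun j => (\- (lL \o ffun_single L _ j) : {linear L -> R^o}) : dual L).
  move=> l.
  have e : lR (f l) + lL (scaled_diag L z l) + lF (i l) = 0.
    rewrite /lR /lL /lF /= -!linearD -[RHS](linear0 lam); congr (lam _).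
    apply/tE; exists l; congr pair; rewrite /= ?add0r //.
    by congr pair; rewrite /= ?addr0 ?add0r.
  have eR : lam (t (inR 1)) * f l = lR (f l).
    by rewrite mulrC -[LHS]/(f l *: lR 1) -linearZ; congr (lR _); apply: mulr1.
  have eL : lL (scaled_diag L z l) = \sum_(j < size z) z`_j * lL (ffun_single L _ j l).
    rewrite [scaled_diag L z l]ffun_sum_single linear_sum; apply: eq_bigr => j _.
    by rewrite ffunE -[RHS]/(z`_j *: lL _) -!linearZ.
  apply/eqP; rewrite eR -subr_eq0; apply/eqP; rewrite -[RHS]e eL.
  have -> : \sum_(j < size z) z`_j * - lL (ffun_single L (size z) j l) =
      - \sum_(j < size z) z`_j * lL (ffun_single L (size z) j l).
    by rewrite -sumrN; apply: eq_bigr => j _; rewrite mulrN.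
  by rewrite opprD !opprK addrA addrAC.
move=> j.
have [x /tE [l ->]|lam hlam] := @factor_onto _ _ _ _ t
  (pair_map (pair_map (scale_map R^o z`_j) (\- (f \o ffun_coord L j)))
     (\0 : {linear F -> R^o})) t1.
  by rewrite /= ffunE linearZ subrr addr0.
exists lam; rewrite [lam _]hlam /= ffunE linear0 subr0 addr0.
exact: mulr1.
Qed.

End HomothetyPushout.
End Extensions.

(** * Dualizing a presentation *)

Section DualSequence.
Variable R : comNzRingType.
Implicit Types (K L M N : lmodType R).

Lemma linear_regularE M (f : {linear R^o -> M}) c : f c = (c : R) *: f 1.
Proof. by rewrite -linearZ; congr (f _); apply/esym/mulr1. Qed.

Definition row_pairing n (v : 'rV[R]_n) : {linear 'rV[R]_n -> R^o} :=
  comb (fun j => v 0 j : R^o).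

Lemma row_pairing_delta n (v : 'rV[R]_n) j : row_pairing v (delta_mx 0 j) = v 0 j.
Proof. exact: comb_delta. Qed.

Lemma row_pairing_linear M n (f : {linear M -> 'rV[R]_n}) :
  linear (fun v => (row_pairing v \o f : {linear M -> R^o}) : dual M).
Proof.
move=> a u v; apply: homP => x /=; rewrite scaler_sumr -big_split /=.
by apply: eq_bigr => j _; rewrite !mxE scalerDr !scalerA mulrC.
Qed.

Definition row_pairing_map M n (f : {linear M -> 'rV[R]_n}) :
  {linear 'rV[R]_n -> dual M} := mk_linear (row_pairing_linear f).

Lemma functional_rowE n (f : {linear 'rV[R]_n -> R^o}) v :
  f v = row_pairing (\row_j f (delta_mx 0 j)) v.
Proof.
by rewrite linear_rowE; apply: eq_bigr => j _; rewrite mxE.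
Qed.

Lemma dual_sequence L K n (y : 'I_n -> L) (i : {linear K -> 'rV[R]_n}) :
  short_exact i (comb y) ->
  (forall f : {linear K -> R^o},
     exists g : {linear 'rV[R]_n -> R^o}, forall x, g (i x) = f x) ->
  exists a : {linear dual L -> 'rV[R]_n},
    short_exact a (row_pairing_map i) /\
    forall (f : dual L) j, a f 0 j = (f : {linear L -> R^o}) (y j).
Proof.
move=> [i1 iy y1] hext.
have al : linear (fun f : dual L => \row_j (f : {linear L -> R^o}) (y j) : 'rV[R]_n).
  by move=> c f g; apply/rowP => j; rewrite !mxE.
have aE (f : dual L) v : row_pairing (mk_linear al f) v = (f : {linear L -> R^o}) (comb y v).
  rewrite linear_sum; apply: eq_bigr => j _.
  by rewrite linearZ mxE.
exists (mk_linear al); split; last by move=> f j; rewrite mxE.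
split.
- apply/injP => f e; apply: homP => x; have [v <-] := y1 x.
  by rewrite -aE e /= big1 // => j _; rewrite mxE scaler0.
- move=> w; split=> [e | [f <-]].
    have [v yv|f hf] := @factor_onto _ _ _ _ (comb y) (row_pairing w) y1.
      have /iy [u <-] := yv.
      by have := congr1 (fun h : dual K => (h : {linear K -> R^o}) u) e.
    exists (f : dual L); apply/rowP => j; rewrite mxE -(comb_delta y j) hf.
    exact: row_pairing_delta.
  apply: homP => u; rewrite [LHS]aE.
  by rewrite (exact_comp0 _ iy) linear0.
- move=> f; have [g hg] := hext f.
  exists (\row_j g (delta_mx 0 j)); apply: homP => u.
  by rewrite -hg [RHS]functional_rowE.
Qed.

Lemma fin_gen_presentation L : fin_gen L ->
  exists n (y : 'I_n -> L) K (i : {linear K -> 'rV[R]_n}), short_exact i (comb y).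
Proof.
move=> /fin_genP [n [y hy]]; have [K [i hi]] := kernel_exists hy.
by exists n, y, K, i.
Qed.

End DualSequence.

(** * The dichotomy *)

Section Dichotomy.
Variable R : comNzRingType.
Hypothesis hR : noetherian R.
Variable m : {pred R}.
Hypothesis hm : local_ring m.
Variable X : subcat R.
Hypothesis hX : resolving X.
Hypothesis hcosyz : closed_under_cosyzygies X.
Variables (k : lmodType R).
Hypothesis hk : residue_field m k.
Hypothesis Xk : ~ X k.
Implicit Types (A B C E G H I K L M N P W : lmodType R).

Lemma regular_mem : X R^o.
Proof.
apply: (resolving_iso hX _ (free_mem hX 1)).
apply: (@iso_of _ _ _ (row_coord 0)).
  by apply/injP => v /= e; apply/rowP => j; rewrite mxE (ord1 j).
by move=> a; exists (\row__ a); rewrite /= mxE.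
Qed.

Lemma pair_mem A B : X A -> X B -> X (A * B)%type.
Proof.
move=> XA XB.
apply: (resolving_ext hX (f := in_left A B) (g := snd) _ XA XB); split.
- by move=> x y [].
- by move=> [x y]; split=> [/= -> | [x' [_ <-]]] //; exists x.
- by move=> y; exists (0, y).
Qed.

Lemma ffun_mem L r : X L -> X {ffun 'I_r -> L}.
Proof.
move=> XL; elim: r => [|r IH].
  apply: (resolving_proj hX); split.
    by exists [::] => u; exists (fun=> 0); rewrite big_ord0; apply/ffunP => -[].
  move=> A B g h hg; exists \0 => u; rewrite linear0.
  have -> : u = 0 by apply/ffunP; case.
  by rewrite linear0.
have tl : linear (fun u : {ffun 'I_r.+1 -> L} =>
    (u ord0, [ffun j => u (lift ord0 j)]) : (L * {ffun 'I_r -> L})%type).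
  by move=> a u v; congr pair; rewrite ?ffunE //=; apply/ffunP => j; rewrite !ffunE.
apply: (resolving_iso hX _ (pair_mem XL IH)).
apply: iso_sym; apply: (@iso_of _ _ _ (mk_linear tl)).
  apply/injP => u [u0 /ffunP hu]; apply/ffunP => j; rewrite ffunE.
  by case: (unliftP ord0 j) => [j' | ] ->; rewrite ?u0 //; have := hu j'; rewrite !ffunE.
move=> [x v]; exists [ffun j => if unlift ord0 j is Some j' then v j' else x].
congr pair; first by rewrite ffunE unlift_none.
by apply/ffunP => j; rewrite !ffunE liftK.
Qed.

(** The torsion of N lies in X; when it is killed by m and nonzero, it is a vector
    space over the residue field k, and k would be one of its summands. *)
Lemma torsion_killed_torsionless N : X N ->
  (forall x : N, (forall f : {linear N -> R^o}, f x = 0) ->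
     forall a, a \in m -> a *: x = 0) -> torsionless N.
Proof.
move=> XN hN.
have [H [I [j [p [[j1 jp p1] XH XI hI hj]]]]] := torsion_sequence hR hm hX hcosyz XN.
have H0 : zero_module H.
  apply: contrapT => h; apply: Xk; apply: (residue_field_mem hR hm hX hk XH) h.
  by move=> a x am; apply: j1; rewrite linearZ linear0; exact: hN.
move=> x hx; have /jp [y <-] : p x = 0 by apply: hI => f; apply: (hx (f \o p)).
by rewrite (H0 y) linear0.
Qed.

Lemma span_ideal_mul (z : seq R^o) (a : R^o) : lin_span z a -> in_ideal_mul z a.
Proof.
case=> c ->; exists c; apply: eq_bigr => i _.
exact: mulrC.
Qed.

(** In other words, m annihilates Ext^1(W, N) for all N. *)
Definition stably_killed W : Prop := forall a, a \in m ->
  exists n (th : {linear W -> 'rV[R]_n}) (rho : {linear 'rV[R]_n -> W}),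
    forall x, rho (th x) = a *: x.

(** If a id_W = rho th and f : W -> P is a left approximation, then th = g f for
    some g, and a id_P - f rho g vanishes on f(W), hence factors through P/f(W). *)
Lemma stably_killed_cosyzygy W n (f : {linear W -> 'rV[R]_n}) C
    (q : {linear 'rV[R]_n -> C}) :
  exact_at f q -> onto q ->
  (forall h : {linear W -> R^o},
     exists g : {linear 'rV[R]_n -> R^o}, forall x, g (f x) = h x) ->
  stably_killed W -> stably_killed C.
Proof.
move=> fq q1 hf hW a am; have [r [th [rho hth]]] := hW a am.
have hg j := hf (row_coord j \o th).
pose g := row_map (fun j => projT1 (cid (hg j))).
have gf x : g (f x) = th x.
  by apply/rowP => j; rewrite mxE; case: cid.
pose d : {linear 'rV[R]_n -> 'rV[R]_n} := scale_map _ a \- (f \o (rho \o g)).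
have dE v : d v = a *: v - f (rho (g v)) by [].
have [v /fq [x <-]|s hs] := @factor_onto _ _ _ _ q d q1.
  by rewrite dE gf hth linearZ subrr.
exists n, s, q => y; have [v <-] := q1 y; rewrite hs dE linearB linearZ.
by rewrite (exact_comp0 _ fq) subr0.
Qed.

Lemma stably_killed_syzygy n W : X W -> stably_killed W -> is_nth_syzygy n W.
Proof.
elim: n W => // n IH W XW hW.
have tW : torsionless W.
  apply: torsion_killed_torsionless => // x hx a am.
  have [r [th [rho <-]]] := hW a am.
  have -> : th x = 0 by apply: torsionless_free => f; apply: (hx (f \o th)).
  exact: linear0.
have [r [f [C [q [fq q1 XC hf]]]]] := cosyzygy_mem hR hm hX hcosyz XW.
exists r, C, f, q; split; last by apply: IH => //; apply: stably_killed_cosyzygy hW.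
split=> //; apply/injP => x fx; apply: tW => h; have [g <-] := hf h.
by rewrite fx linear0.
Qed.

Section Presentation.
Variables (z : seq R^o) (zm : {subset z <= m}).
Hypothesis mz : forall a, a \in m -> lin_span z a.
Variables (M L : lmodType R) (n : nat) (x : 'I_n -> M) (i : {linear L -> 'rV[R]_n}).
Hypothesis hip : short_exact i (comb x).
Hypothesis XM : X M.

Lemma presentation_mem : X L.
Proof. exact: (resolving_ker hX hip (free_mem hX n) XM). Qed.

Lemma homothety_pushout :
  exists E (q : {linear ({ffun 'I_(size z) -> L} * 'rV[R]_n)%type -> E}),
  [/\ onto q, forall u, q u = 0 <-> exists l, u = (scaled_diag L z l, i l),
      X E & torsionless E].
Proof.
have [E [q [a [b [q1 qE hab aE bE]]]]] := pushout_exists (scaled_diag L z) hip.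
have XE : X E by apply: (resolving_ext hX hab) XM; apply/ffun_mem/presentation_mem.
exists E, q; split=> //; apply: torsion_killed_torsionless => // h hh c cm.
exact: (pushout_torsion_killed hip q1 qE hh (mz cm)).
Qed.

Lemma ext1_zero_of_mul :
  (forall f : {linear L -> R^o},
     exists (g : {linear 'rV[R]_n -> R^o}) (u : nat -> dual L),
     forall l, f l = g (i l) + \sum_(j < size z) z`_j * (u j : {linear L -> R^o}) l) ->
  forall f : {linear L -> R^o},
    exists g : {linear 'rV[R]_n -> R^o}, forall l, g (i l) = f l.
Proof.
move=> h f.
pose S (f : dual L) := exists g : {linear 'rV[R]_n -> R^o},
  forall l, g (i l) = (f : {linear L -> R^o}) l.
have hS : is_submod S.
  split; first by exists \0 => l; rewrite /=.
  move=> a f1 f2 [g1 h1] [g2 h2].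
  by exists (a \*: g1 \+ g2) => l; rewrite /= h1 h2.
have fgL := fin_gen_dual hR (resolving_fg hX presentation_mem).
apply: (nakayama hR hm fgL hS zm).
move=> {}f; have [g [u hu]] := h (f : {linear L -> R^o}).
exists (\sum_(j < size z) z`_j *: u j); split; first by exists u.
exists g => l.
have ev : linear (fun h : dual L => (h : {linear L -> R^o}) l) by [].
have -> : (f - \sum_(j < size z) z`_j *: u j : {linear L -> R^o}) l =
    f l - mk_linear ev (\sum_(j < size z) z`_j *: u j) by [].
rewrite linear_sum hu -[LHS]addr0 -addrA; congr (_ + _).
by apply/esym/eqP; rewrite subr_eq0; apply/eqP/eq_bigr => j _; rewrite linearZ.
Qed.

End Presentation.

(** A functional f on L that is not in the sum of mL* and the restrictions of
    functionals on F yields an extension G of E by R on which the values at e(1)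
    form exactly m. The cokernel W of R -> G -> P, for a left approximation of G, is
    then an arbitrarily high syzygy, while e(1) is mapped into mP. *)
Lemma torsionless_ext1_zero M : X M -> torsionless M -> ext1_zero M.
Proof.
move=> XM tM; have [z [zm mz]] := m_gens hR hm.
have [n [x [L [i hip]]]] := fin_gen_presentation (resolving_fg hX XM).
apply: (ext1_zero_presentation hip (@projective_free _ n)).
apply: (ext1_zero_of_mul zm hip XM) => f; apply: contrapT => hf.
have [E [q [q1 qE XE tE]]] := homothety_pushout mz hip XM.
have [G [e [b [heb hval hz]]]] := homothety_extension hip q1 qE f.
have [e1 eb b1] := heb.
have XG : X G by apply: (resolving_ext hX heb) XE; apply: regular_mem.
(* A unit among the values would express f in the excluded form. *)
have val_m (lam : {linear G -> R^o}) : lam (e 1) \in m.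
  apply/negPn/negP => /(local_unit hR hm) [c hc]; apply: hf.
  have [g [u hu]] := hval lam; exists (c \*: g), (fun j => c *: u j) => l.
  rewrite -[f l]mul1r -hc -mulrA hu mulrDr mulr_sumr; congr (_ + _).
  by apply: eq_bigr => j _; rewrite mulrCA.
have m_val a : a \in m -> exists lam : {linear G -> R^o}, lam (e 1) = a.
  move=> am; pose V (c : R^o) := exists lam : {linear G -> R^o}, lam (e 1) = c.
  apply: (@span_sub _ R^o V z _ _ _ (mz a am)).
    split; first by exists \0.
    by move=> c _ _ [l1 <-] [l2 <-]; exists (c \*: l1 \+ l2).
  move=> _ /(nthP 0) [j jz <-].
  exact: (hz (Ordinal jz)).
have tG : torsionless G.
  apply: torsion_killed_torsionless => // h hh a am.
  have /eb [c ec] : b h = 0 by apply: tE => g; apply: (hh (g \o b)).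
  have [lam hlam] := m_val a am.
  have ca : c * a = 0.
    by have := hh lam; rewrite -ec (linear_regularE e) linearZ hlam.
  by rewrite -ec -linearZ -[a *: c]/(a * c) mulrC ca linear0.
have [r [g [C [q' [gq' q1' XC hg]]]]] := cosyzygy_mem hR hm hX hcosyz XG.
have g1 : injective g.
  by apply/injP => h gh; apply: tG => lam; have [u <-] := hg lam; rewrite gh linear0.
pose ge : {linear R^o -> 'rV[R]_r} := g \o e.
have [W [w [w1 wE]]] := quotient_exists (im_submod ge).
have hW : short_exact ge w.
  by split=> // x1 x2 /g1 /e1.
(* W is an extension of C by E = G/R. *)
have XW : X W.
  have [h /eb [c <-]|a ha] := @factor_onto _ _ _ _ b (w \o g) b1.
    by apply/wE; exists c.
  have [v /wE [c <-]|d hd] := @factor_onto _ _ _ _ w q' w1.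
    by rewrite (exact_comp0 _ gq').
  apply: (resolving_ext hX (f := a) (g := d) _ XE XC); split.
  - apply/injP => y; have [h <-] := b1 y; rewrite ha => /wE [c /g1 <-].
    exact: exact_comp0 eb.
  - move=> y; have [v <-] := w1 y; rewrite hd; split=> [/gq' [h <-] | [y']].
      by exists (b h); rewrite ha.
    have [h <-] := b1 y'; rewrite ha /= => hwv.
    by rewrite -hd -hwv hd (exact_comp0 _ gq').
  - by move=> y; have [v <-] := q1' y; exists (w v); rewrite hd.
(* A functional on the free module with value a at g(e(1)) makes multiplication
   by a on W factor through this module. *)
have QW : stably_killed W.
  move=> a am; have [lam hlam] := m_val a am; have [u hu] := hg lam.
  pose d : {linear 'rV[R]_r -> 'rV[R]_r} := scale_map _ a \- (scale_vec (ge 1) \o u).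
  have dE v : d v = a *: v - (u v : R) *: ge 1 by [].
  have [v /wE [c <-]|th hth] := @factor_onto _ _ _ _ w d w1.
    have uge : u (ge 1) = a by rewrite -hlam; apply: hu.
    by rewrite dE (linear_regularE ge) [u _]linearZ /= uge !scalerA mulrC; apply: subrr.
  exists r, th, w => y; have [v <-] := w1 y; rewrite hth dE linearB.
  have we : w (ge 1) = 0 by apply/wE; exists 1.
  by rewrite [w (_ *: ge 1)]linearZ /= we scaler0 subr0; apply: linearZ.
pose idR : {linear R^o -> R^o} := idfun.
apply: (@no_infinite_coresolution _ hR _ hm _ _ _ ge w 1 idR z hW) => //.
  apply/ideal_mul_row => j; apply: span_ideal_mul; apply: mz.
  exact: (val_m (row_coord j \o g)).
by move=> l; apply: stably_killed_syzygy.
Qed.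

Lemma dual_nth_syzygy l L : X L -> torsionless L -> is_nth_syzygy l (dual L).
Proof.
elim: l L => // l IH L XL tL.
have [n [y [K [i hiy]]]] := fin_gen_presentation (resolving_fg hX XL).
have XK := presentation_mem hiy XL.
have [a [ha _]] := dual_sequence hiy (torsionless_ext1_zero XL tL hiy).
exists n, (dual K), a, (row_pairing_map i); split=> //; apply: IH => //.
by case: hiy => i1 _ _; apply: torsionless_inj i1 _; apply: torsionless_free.
Qed.

(** Let K be the torsion of M, and suppose that it is not zero. Then K* = 0, since
    functionals on K extend to M, and Ext^1(K, R) = 0 by applying the previous
    results to the homothety pushout of K. If L is the kernel of a minimal free cover
    F of K, then F* = L*, and for a free cover F' of L the cokernel of L* -> F'* is an
    arbitrarily high syzygy. The composite F* -> F'* has its image in mF'*. *)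
Lemma resolving_torsionless M : X M -> torsionless M.
Proof.
move=> XM; have [K [I [j [p [hjp XK XI tI hj]]]]] := torsion_sequence hR hm hX hcosyz XM.
have K0 (f : {linear K -> R^o}) h : f h = 0.
  by have [g <-] := torsionless_ext1_zero XI tI hjp f; apply: hj.
case: (hjp) => j1 jp p1.
suff Kz : zero_module K.
  move=> x hx; have /jp [y <-] : p x = 0 by apply: tI => f; apply: (hx (f \o p)).
  by rewrite (Kz y) linear0.
have [z [zm mz]] := m_gens hR hm.
have [[|n] [x [x1 xm]]] := minimal_generators hR hm (resolving_fg hX XK).
  by move=> y; have [v <-] := x1 y; rewrite /= big_ord0.
exfalso; have [L [i hip]] := kernel_exists x1.
have XL := presentation_mem hip XK.
case: (hip) => i1 ip _.
have tL : torsionless L by apply: torsionless_inj i1 _; apply: torsionless_free.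
have [E [q [q1 qE XE tE]]] := homothety_pushout mz hip XK.
have hext := ext1_zero_of_mul zm hip XK.
have {}hext : forall f : {linear L -> R^o},
    exists g : {linear 'rV[R]_n.+1 -> R^o}, forall l, g (i l) = f l.
  apply: hext => f; have [G [e [b [heb hval _]]]] := homothety_extension hip q1 qE f.
  have [lam hlam] := torsionless_ext1_zero XE tE heb (idfun : {linear R^o -> R^o}).
  by have [g [u hu]] := hval lam; exists g, u => l; rewrite -hu hlam mul1r.
have [r [y [L1 [i' hiy]]]] := fin_gen_presentation (resolving_fg hX XL).
have XL1 := presentation_mem hiy XL.
have tL1 : torsionless L1.
  by case: hiy => i1' _ _; apply: torsionless_inj i1' _; apply: torsionless_free.
have [a [[a1 ab b1] aE]] := dual_sequence hiy (torsionless_ext1_zero XL tL hiy).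
pose c : {linear 'rV[R]_n.+1 -> dual L} := row_pairing_map i.
have cE v l : (c v : {linear L -> R^o}) l = row_pairing v (i l) by [].
pose ac : {linear 'rV[R]_n.+1 -> 'rV[R]_r} := a \o c.
have hac : short_exact ac (row_pairing_map i').
  split=> //.
    apply/injP => v; rewrite -[0](linear0 a) => /a1 cv.
    have [u /ip [l <-]|f hf] := @factor_onto _ _ _ _ (comb x) (row_pairing v) x1.
      by rewrite -cE cv.
    apply/rowP => t; rewrite -row_pairing_delta -hf K0.
    by rewrite mxE.
  move=> v; rewrite ab; split=> [[f <-] | [u <-]]; last by exists (c u).
  have [g hg] := hext (f : {linear L -> R^o}).
  exists (\row_t g (delta_mx 0 t)); congr (a _); apply: homP => l.
  by rewrite cE -functional_rowE hg.
apply: (@no_infinite_coresolution _ hR _ hm _ _ _ ac _ (delta_mx 0 0)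
  (row_coord 0) z hac) => //.
- by rewrite /= mxE !eqxx.
- apply/ideal_mul_row => t; apply: span_ideal_mul; apply: mz.
  rewrite aE cE.
  (* The generators of K are minimal, so i(L) has coordinates in m. *)
  have -> : row_pairing (delta_mx 0 0) (i (y t)) = i (y t) 0 0.
    rewrite /= (bigD1 0) //= mxE !eqxx big1 ?addr0 => [|s s0].
      exact: mulr1.
    by rewrite mxE (negbTE s0) andbF scaler0.
  by apply: xm; apply: exact_comp0 ip.
- by move=> l; apply: dual_nth_syzygy.
Qed.

Lemma resolving_ext1_zero M : X M -> ext1_zero M.
Proof. by move=> XM; apply: torsionless_ext1_zero => //; apply: resolving_torsionless. Qed.

End Dichotomy.

(** * Total reflexivity *)

Section Coverings.
Variable R : comNzRingType.
Implicit Types (K M N P : lmodType R) (Z : subcat R).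

(** A class of modules that all have a covering is stable under some choice of
    syzygies, and Ext^1(-, R) vanishes on its members; splicing the coverings gives
    projective resolutions that show the vanishing of all Ext^i(-, R). *)
Record covering Z N := Covering {
  cov_ker : lmodType R;
  cov_proj : lmodType R;
  cov_incl : {linear cov_ker -> cov_proj};
  cov_map : {linear cov_proj -> N};
  cov_projective : projective cov_proj;
  cov_exact : short_exact cov_incl cov_map;
  cov_extend : forall f : {linear cov_ker -> R^o},
    exists g : {linear cov_proj -> R^o}, forall x, g (cov_incl x) = f x;
  cov_mem : Z cov_ker }.

Variables (Z : subcat R) (hZ : forall N, Z N -> inhabited (covering Z N)).

Let cov (s : {N | Z N}) : covering Z (sval s) :=
  projT1 (cid (let: inhabits c := hZ (proj2_sig s) in ex_intro xpredT c isT)).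

Let stage N (hN : Z N) : nat -> {N | Z N} :=
  fix st n := if n is n'.+1 then exist Z _ (cov_mem (cov (st n'))) else exist Z N hN.

Let stage_mod N (hN : Z N) n := cov_proj (cov (stage hN n)).

Let stage_diff N (hN : Z N) n : {linear stage_mod hN n.+1 -> stage_mod hN n} :=
  cov_incl (cov (stage hN n)) \o cov_map (cov (stage hN n.+1)).

Let stage_exact0 N (hN : Z N) : exact_at (stage_diff hN 0) (cov_map (cov (stage hN 0))).
Proof.
case: (cov_exact (cov (stage hN 0))) => _ h _.
case: (cov_exact (cov (stage hN 1))) => _ _ h'.
move=> y; rewrite h; split=> [[x <-] | [x <-]].
  by have [x' <-] := h' x; exists x'.
by exists (cov_map (cov (stage hN 1)) x).
Qed.

Let stage_exact N (hN : Z N) n : exact_at (stage_diff hN n.+1) (stage_diff hN n).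
Proof.
case: (cov_exact (cov (stage hN n))) => /injP h0 _ _.
case: (cov_exact (cov (stage hN n.+1))) => _ h _.
case: (cov_exact (cov (stage hN n.+2))) => _ _ h'.
move=> y; split=> [/h0/h [x <-] | [x <-]].
  by have [x' <-] := h' x; exists x'.
rewrite /stage_diff /= (_ : cov_map _ _ = 0) ?linear0 //.
by apply/h; exists (cov_map (cov (stage hN n.+2)) x).
Qed.

Let stage_resolution N (hN : Z N) : proj_resolution N :=
  @ProjResolution R N (stage_mod hN) (stage_diff hN) (cov_map (cov (stage hN 0)))
    (fun n => @cov_projective _ _ (cov (stage hN n)))
    (let: And3 _ _ h := cov_exact (cov (stage hN 0)) in h)
    (@stage_exact0 N hN) (@stage_exact N hN).

(** A cocycle on the (i+1)-st module of the spliced resolution is a functional on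
    the i-th kernel, and extends to the i-th projective module. *)
Lemma Ext_eq0_covering N i : Z N -> (0 < i)%N -> Ext_eq0 i N R^o.
Proof.
move=> hN; case: i => // i _; exists (stage_resolution hN) => f hf.
case: (cov_exact (cov (stage hN i.+1))) => _ h hp.
case: (cov_exact (cov (stage hN i.+2))) => _ _ hp'.
have [x /h [y <-]|f' hf'] := factor_onto (g := f : {linear stage_mod hN i.+1 -> R^o}) hp.
  by have [x' <-] := hp' y; apply: hf.
have [g hg] := cov_extend f'.
exists g => x; rewrite -hf'.
exact: hg.
Qed.

End Coverings.

Section TotallyReflexive.
Variable R : comNzRingType.
Hypothesis hR : noetherian R.
Variable m : {pred R}.
Hypothesis hm : local_ring m.
Variable X : subcat R.
Hypothesis hX : resolving X.
Hypothesis hcosyz : closed_under_cosyzygies X.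
Hypothesis X_torsionless : forall M, X M -> torsionless M.
Hypothesis X_ext1_zero : forall M, X M -> ext1_zero M.
Implicit Types (C K L M N : lmodType R).

Lemma row_pairingC n (u v : 'rV[R]_n) : row_pairing u v = row_pairing v u.
Proof. by apply: eq_bigr => j _; apply: mulrC. Qed.

(** The cosyzygy sequence of M dualizes to an exact sequence, in which the dual of
    the projection onto the cosyzygy is again an embedding in a free module. *)
Lemma dual_coresolution M : X M -> exists n C (f : {linear M -> 'rV[R]_n})
    (q : {linear 'rV[R]_n -> C}) (a : {linear dual C -> 'rV[R]_n}),
  [/\ X C, short_exact f q, short_exact a (row_pairing_map f) &
      forall (h : dual C) v, row_pairing (a h) v = (h : {linear C -> R^o}) (q v)].
Proof.
move=> XM; have [n [f [C [q [fq q1 XC hf]]]]] := cosyzygy_mem hR hm hX hcosyz XM.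
have fi : injective f.
  apply/injP => x fx; apply: X_torsionless => // h; have [g <-] := hf h.
  by rewrite fx linear0.
have qE v : q v = comb (fun j => q (delta_mx 0 j)) v by rewrite linear_rowE.
have hfq : short_exact f (comb (fun j => q (delta_mx 0 j))).
  split=> // [v|c]; first by rewrite -qE; apply: fq.
  by have [v <-] := q1 c; exists v; rewrite -qE.
have [a [ha aE]] := dual_sequence hfq (X_ext1_zero XC hfq).
exists n, C, f, q, a; split=> // h v; rewrite qE linear_sum; apply: eq_bigr => j _.
by rewrite aE linearZ.
Qed.

(** An element of M** restricts along P* -> M* to evaluation at some p in P. All
    functionals on the cosyzygy C vanish at the image of p, so p lies in M, since C
    is torsionless. *)
Lemma resolving_reflexive M : X M -> bijective (@biduality R M).
Proof.
move=> XM; have [n [C [f [q [a [XC [f1 fq q1] [a1 af f1'] aE]]]]]] := dual_coresolution XM.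
have bi : injective (@biduality R M).
  move=> x y e; apply/subr0_eq; apply: X_torsionless => // h.
  have := congr1 (fun u : dual (dual M) => (u : {linear dual M -> R^o}) (h : dual M)) e.
  by rewrite /biduality /= /eval_at linearB => ->; rewrite subrr.
have bo : forall y, exists x, @biduality R M x = y.
  move=> Phi; pose F : {linear 'rV[R]_n -> R^o} :=
    (Phi : {linear dual M -> R^o}) \o row_pairing_map f.
  pose p := \row_j F (delta_mx 0 j).
  have FE v : F v = row_pairing p v by apply: functional_rowE.
  have /fq [x fx] : q p = 0.
    apply: X_torsionless => // h; rewrite -(aE (h : dual C)) row_pairingC -FE /F /=.
    by rewrite [X in (Phi : {linear dual M -> R^o}) X](exact_comp0 _ af) linear0.
  exists x; apply: homP => h; have [w <-] := f1' h.
  rewrite -[RHS]/(F w) FE row_pairingC -fx.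
  by [].
exists (fun y => projT1 (cid (bo y))) => [x|y]; last by case: cid.
by apply: bi; case: cid.
Qed.

Lemma resolving_totally_reflexive M : X M -> totally_reflexive M.
Proof.
move=> XM; split; first exact: (resolving_fg hX XM).
- exact: resolving_reflexive.
- move=> i; apply: Ext_eq0_covering XM => N XN.
  have [n [y [K [j hj]]]] := fin_gen_presentation (resolving_fg hX XN).
  have XK : X K by apply: (resolving_ker hX hj _ XN); apply: free_mem.
  by split; exists K 'rV[R]_n j (comb y) => //; [apply: projective_free | apply: X_ext1_zero hj].
- have hN : exists2 M', X M' & dual M = dual M' by exists M.
  move=> i; apply: (@Ext_eq0_covering _ (fun N => exists2 M, X M & N = dual M)) hN.
  move=> N [{XM}M XM ->].
  have [n [C [f [q [a [XC hfq ha aE]]]]]] := dual_coresolution XM.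
  split; exists (dual C) 'rV[R]_n a (row_pairing_map f) => //; last by exists C.
    exact: projective_free.
  move=> Phi; have [c cPhi] : exists c, @biduality R C c = Phi.
    by have [s _ hs] := resolving_reflexive XC; exists (s Phi).
  have [_ _ q1] := hfq; have [v qv] := q1 c.
  exists (row_pairing v) => h; rewrite row_pairingC aE qv.
  by rewrite -[RHS]/((Phi : {linear dual C -> R^o}) h) -cPhi.
Qed.

End TotallyReflexive.

(** * The torsion with respect to the maximal ideal *)

Section MaximalTorsion.
Variable R : comNzRingType.
Hypothesis hR : noetherian R.
Variable m : {pred R}.
Hypothesis hm : local_ring m.
Implicit Types (A B C K L M N : lmodType R).

(** This is m^t x = 0, stated without the ideal m^t. *)
Fixpoint killed M t (x : M) : Prop :=
  if t is t'.+1 then forall a, a \in m -> killed t' (a *: x) else x = 0.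

Lemma killed_submod M t : is_submod (@killed M t).
Proof.
elim: t => [|t [IH0 IH]] /=; first by split=> // a x y -> ->; rewrite scaler0 addr0.
split=> [a _ | c x y hx hy a am]; first by rewrite scaler0.
rewrite scalerDr scalerA mulrC -scalerA.
by apply: IH; [apply: hx | apply: hy].
Qed.

Lemma killedS M t (x : M) : killed t x -> killed t.+1 x.
Proof.
move=> h a _; apply: submodZ => //; exact: killed_submod.
Qed.

Lemma killed_le M s t (x : M) : (s <= t)%N -> killed s x -> killed t x.
Proof.
move/subnKC <-; elim: (t - s)%N => [|d IH]; rewrite ?addn0 // addnS => /IH.
exact: killedS.
Qed.

Lemma killed_linear M N (f : {linear M -> N}) t x : killed t x -> killed t (f x).
Proof.
elim: t x => [x /= ->|t IH x h a am]; first exact: linear0.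
by rewrite -linearZ; apply/IH/h.
Qed.

Lemma killed_inj M N (f : {linear M -> N}) t x :
  injective f -> killed t (f x) -> killed t x.
Proof.
move=> hf; elim: t x => [x /= e|t IH x h a am]; first by apply: hf; rewrite e linear0.
by apply: IH; rewrite linearZ; apply: h.
Qed.

Definition torsion_bound t M : Prop := forall s (x : M), killed s x -> killed t x.

Lemma torsion_bound_le s t M : (s <= t)%N -> torsion_bound s M -> torsion_bound t M.
Proof. by move=> st h r x /h; apply: killed_le. Qed.

Lemma torsion_bound_inj M N (f : {linear M -> N}) t :
  injective f -> torsion_bound t N -> torsion_bound t M.
Proof.
by move=> hf h s x /(killed_linear f) /h; apply: killed_inj.
Qed.

Lemma torsion_bound_iso M N t : iso M N -> torsion_bound t N -> torsion_bound t M.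
Proof. by move=> [f hf]; apply: (torsion_bound_inj (f := f)); apply: bij_inj. Qed.

Lemma torsion_bound_fin_gen M : fin_gen M -> exists t, torsion_bound t M.
Proof.
move=> hM; have hS : is_submod (fun x : M => exists s, killed s x).
  split; first by exists 0%N.
  move=> a x y [s hs] [t ht]; exists (maxn s t).
  case: (@killed_submod M (maxn s t)) => _; apply.
    by apply: killed_le hs; rewrite leq_maxl.
  by apply: killed_le ht; rewrite leq_maxr.
have [g [g1 g2]] := noeth_fin_gen hR hM hS.
have [t ht] : exists t, forall x, x \in g -> killed t x.
  elim: g g1 {g2} => [|a g IH] g1; first by exists 0%N.
  have [t ht] := IH (fun x xs => g1 x (mem_behead (s := a :: g) xs)).
  have [s hs] : exists s, killed s a by apply: g1; rewrite inE eqxx.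
  exists (maxn s t) => x; rewrite inE => /orP [/eqP -> | /ht].
    by apply: killed_le hs; rewrite leq_maxl.
  by apply: killed_le; rewrite leq_maxr.
exists t => s x hx; apply: (span_sub (@killed_submod M t) ht); apply: g2.
by exists s.
Qed.

Lemma torsion_bound_pair A B t :
  torsion_bound t A -> torsion_bound t B -> torsion_bound t (A * B)%type.
Proof.
move=> hA hB s [x y] h; rewrite pairE.
apply: submodD; first exact: killed_submod.
  by apply/killed_linear/(hA s)/(killed_linear (fst : {linear (A * B)%type -> A}) h).
by apply/killed_linear/(hB s)/(killed_linear (snd : {linear (A * B)%type -> B}) h).
Qed.

Lemma torsion_bound_ext A B C (i : {linear A -> B}) (p : {linear B -> C}) s t :
  short_exact i p -> torsion_bound s A -> torsion_bound t C -> torsion_bound (s + t) B.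
Proof.
move=> [i1 ip p1] hA hC r x hx.
move: (hC r _ (killed_linear p hx)) => {hC}.
elim: t x hx => [|t IH] x hx hpx.
  have /ip [y yx] := hpx; rewrite addn0 -yx; apply/killed_linear/(hA r).
  by apply: killed_inj i1 _; rewrite yx.
rewrite addnS => a am; apply: IH; first by apply: submodZ => //; apply: killed_submod.
by rewrite linearZ; apply: hpx.
Qed.

Lemma torsion_bound_free n t : torsion_bound t R^o -> torsion_bound t 'rV[R]_n.
Proof.
move=> h s v hv; rewrite (row_sum_delta v); apply: submod_sum => [|j].
  exact: killed_submod.
apply: (killed_linear (scale_vec (delta_mx 0 j))); apply: (h s).
exact: (killed_linear (row_coord j)).
Qed.

Lemma torsion_bound_projective P t :
  fg_projective P -> torsion_bound t R^o -> torsion_bound t P.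
Proof.
move=> /fg_projective_retract [n [a [b ab]]] h.
by apply: (torsion_bound_inj (can_inj ab)); apply: torsion_bound_free.
Qed.

(** Higher syzygies embed in free modules, so only R and the modules of Y
    themselves matter. *)
Lemma torsion_bound_bracket Y t M : torsion_bound t R^o ->
  (forall N, Y N -> torsion_bound t N) -> bracket Y M -> torsion_bound t M.
Proof.
move=> tR hY [N hN [M' [f hf]]].
have [g [fg gf]] := iso_inv hf.
suff tN : torsion_bound t N.
  apply: (torsion_bound_inj (f := g \o in_left M M')) tN => x y /= /(can_inj gf).
  by case.
elim: hN => {f g hf fg gf M M' N} [M M0 | M L N hL _ tN hM].
  by move=> s x _; rewrite (M0 x); case: (@killed_submod M t).
apply: torsion_bound_iso hM _; apply: torsion_bound_pair => //.
case: hL => [/iso_sym hL | [M' YM' [i hi]]]; first exact: torsion_bound_iso hL _.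
case: i hi => [/= /iso_sym hi | i [K _ [P [j [p [[hP _ _] [j1 _ _]]]]]]].
  by apply: torsion_bound_iso hi _; apply: hY.
by apply: torsion_bound_inj j1 _; apply: torsion_bound_projective.
Qed.

Lemma torsion_bound_ball C n t M : torsion_bound t R^o -> torsion_bound t C ->
  radius_ball C n M -> torsion_bound (t * n.+1) M.
Proof.
move=> tR tC.
have t1 N : bracket (iso C) N -> torsion_bound t N.
  apply: torsion_bound_bracket => // N' /iso_sym hN'.
  exact: torsion_bound_iso hN' tC.
elim: n M => [|n IH] M /=; first by rewrite muln1; apply: t1.
apply: torsion_bound_bracket.
  by apply: torsion_bound_le tR; rewrite leq_pmulr.
move=> N [A [B [f [g [hA hB hfg]]]]]; rewrite mulnS addnC.
by apply: (torsion_bound_ext hfg); [apply: IH | apply: t1].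
Qed.

Fixpoint power_gens (z : seq R) t : seq R^o :=
  if t is t'.+1 then [seq a * b | a <- z, b <- power_gens z t'] else [:: 1].

Lemma span_mul (z w : seq R^o) a b : lin_span z a -> lin_span w b ->
  lin_span ([seq (c : R) * d | c <- z, d <- w] : seq R^o) ((a : R) * b : R^o).
Proof.
set u := (X in _ -> _ -> @lin_span _ _ X _) => ha hb.
have hu := @span_submod R R^o u.
apply: (@span_sub _ R^o (fun b => @lin_span R R^o u ((a : R) * b : R^o)) w) hb.
  split; first by rewrite mulr0; case: hu.
  move=> r x y hx hy; rewrite mulrDr -[r *: x]/(r * x) mulrCA.
  by case: hu => _; apply.
move=> d dw; apply: (@span_sub _ R^o (fun a => @lin_span R R^o u ((a : R) * d : R^o)) z) ha.
  split; first by rewrite mul0r; case: hu.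
  move=> r x y hx hy; rewrite mulrDl -[r *: x]/(r * x) -mulrA.
  by case: hu => _; apply.
by move=> c cz; apply: span_mem; apply/allpairsP; exists (c, d).
Qed.

End MaximalTorsion.

(** * Modules of finite length and the radius *)

Section FiniteLength.
Variable R : comNzRingType.
Hypothesis hR : noetherian R.
Variable m : {pred R}.
Hypothesis hm : local_ring m.
Variable X : subcat R.
Hypothesis hX : resolving X.
Variables (k : lmodType R).
Hypothesis hk : residue_field m k.
Hypothesis Xk : X k.
Implicit Types (A B C K L M N : lmodType R).

Lemma zero_mem N : zero_module N -> X N.
Proof.
move=> N0; apply: (resolving_proj hX); split.
  by exists [::] => x; rewrite (N0 x); case: (span_submod ([::] : seq N)).
by move=> A B g h _; exists \0 => x; rewrite (N0 x) !linear0.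
Qed.

Lemma killed_cyclic_mem N (x : N) : onto (scale_vec x) ->
  (forall a, a \in m -> a *: x = 0) -> X N.
Proof.
move=> x1 mx; have [q [q1 qE]] := hk.
have [x0 | x0] := pselect (x = 0).
  by apply: zero_mem => y; have [a <-] := x1 y; rewrite /= x0 scaler0.
have [f hf] : exists f : {linear k -> N}, forall a, f (q a) = scale_vec x a.
  by apply: factor_onto => // a /qE; apply: mx.
apply: (resolving_iso hX _ Xk); apply: (@iso_of _ _ _ f).
  apply/injP => y; have [a <-] := q1 y; rewrite hf /= => ax; apply/qE.
  apply/negPn/negP => /(local_unit hR hm) [b ba]; apply: x0.
  by rewrite -[x]scale1r -ba -scalerA ax scaler0.
by move=> y; have [a <-] := x1 y; exists (q a).
Qed.

Lemma killed1_mem n N (x : 'I_n -> N) : onto (comb x) ->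
  (forall a (y : N), a \in m -> a *: y = 0) -> X N.
Proof.
elim: n N x => [|n IH] N x x1 mN.
  by apply: zero_mem => y; have [v <-] := x1 y; rewrite /= big_ord0.
pose x' := comb (fun j => x (lift ord0 j)).
have [K [i [i1 iE]]] := submodule_exists (im_submod x').
have [Q [q [q1 qE]]] := quotient_exists (im_submod x').
have hiq : short_exact i q by split=> // y; rewrite qE iE.
apply: (resolving_ext hX hiq).
  have hx j : exists y, i y = x (lift ord0 j).
    by apply/iE; exists (delta_mx 0 j); apply: comb_delta.
  pose y j := projT1 (cid (hx j)).
  have yE j : i (y j) = x (lift ord0 j) by rewrite /y; case: cid.
  apply: (IH K y).
    move=> u; have [v vu] : exists v, x' v = i u by apply/iE; exists u.
    exists v; apply: i1; rewrite -vu linear_sum.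
    by apply: eq_bigr => j _; rewrite linearZ yE.
  by move=> a u am; apply: i1; rewrite linearZ linear0; apply: mN.
apply: (@killed_cyclic_mem Q (q (x ord0))).
  move=> y; have [u <-] := q1 y; have [v <-] := x1 u.
  exists (v 0 ord0); rewrite /= -linearZ; apply/linear_eq_ker/qE.
  exists (- \row_j v 0 (lift ord0 j)); rewrite linearN /=.
  rewrite [in RHS]big_ord_recl opprD addrA subrr add0r.
  by congr (- _); apply: eq_bigr => j _; rewrite mxE.
by move=> a am; rewrite -linearZ mN // linear0.
Qed.

(** Such a module has finite length; the elements killed by m^t form a submodule
    with a quotient killed by m. *)
Lemma killed_mem t N : fin_gen N -> (forall x : N, killed m t x) -> X N.
Proof.
elim: t N => [|t IH] N hN kN; first exact: zero_mem.
have [K [i [i1 iE]]] := submodule_exists (@killed_submod _ m N t).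
have [Q [q [q1 qE]]] := quotient_exists (@killed_submod _ m N t).
have hiq : short_exact i q by split=> // y; rewrite qE iE.
apply: (resolving_ext hX hiq).
  apply: IH; first exact: fin_gen_inj hR i1 hN.
  by move=> x; apply: killed_inj i1 _; apply/iE; exists x.
have /fin_genP [n [x x1]] := fin_gen_onto q1 hN.
apply: (killed1_mem x1) => a y am; have [u <-] := q1 y.
by rewrite -linearZ; apply/qE; apply: kN.
Qed.

(** If the m-torsion of all modules in X were annihilated by m^T, then applying
    this to R/m^(T+1) would give m^T = m^(T+1), hence m^T = 0 by Nakayama, and the
    nilpotent ideal m would lie in every prime ideal. *)
Lemma torsion_bound_dim0 T : (forall M, X M -> torsion_bound m T M) ->
  ~ krull_dim_gt R 0.
Proof.
move=> hT; have [z [zm mz]] := m_gens hR hm.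
pose J t : R^o -> Prop := lin_span (power_gens z t).
have JS a b t : a \in m -> J t b -> J t.+1 (a * b).
  by move=> /mz ha hb; apply: (span_mul ha hb).
have JT w : w \in power_gens z T -> J T.+1 w.
  have [Q [q [q1 qE]]] := quotient_exists (span_submod (power_gens z T.+1)).
  have kQ s r y : (s + r = T.+1)%N -> J s y -> killed m r (q y).
    elim: r s y => [|r IH] s y.
      by rewrite addn0 => -> hy; apply/qE.
    rewrite addnS -addSn => e hy a am; rewrite -linearZ.
    by apply: IH e _; apply: JS.
  have hQ : X Q.
    apply: (@killed_mem T.+1) => [|x].
      exact: fin_gen_onto q1 (fin_gen_regular R).
    have [y <-] := q1 x; apply: (kQ 0%N) => //.
    exact: span_one.
  have k1 : killed m T (q 1).
    apply: (hT _ hQ T.+1); apply: (kQ 0%N) => //; exact: span_one.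
  have kJ t y u : killed m t (q y) -> u \in power_gens z t -> J T.+1 (u * y).
    elim: t y u => [|t IH] y u /=.
      by move=> /qE hy; rewrite inE => /eqP ->; rewrite mul1r.
    move=> hy /allpairsP [[a b] [/= az bt ->]].
    rewrite mulrC mulrA mulrC; apply: IH bt.
    by rewrite mulrC -[a * y]/(a *: y) linearZ; apply: hy; apply: zm.
  by move=> wT; rewrite -[w]mulr1; apply: kJ wT.
have J0 w : w \in power_gens z T -> w = 0.
  apply: (@nakayama_seq _ hR _ hm _ (fun x : R^o => x = 0) (power_gens z T)).
    by split=> // a x y -> ->; rewrite scaler0 addr0.
  move=> x /JT; set s := power_gens z T.
  pose S (x : R^o) := exists c : nat -> R, (forall i, c i \in m) /\
    x - \sum_(i < size s) c i *: s`_i = 0.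
  apply: (@span_sub _ R^o S).
    split; first by exists (fun=> 0); split=> [i|]; [case: (m_submod hm) |
      rewrite big1 ?subrr // => i _; rewrite scale0r].
    move=> a u v [c [c1 /subr0_eq c2]] [d [d1 /subr0_eq d2]].
    exists (fun i => a * c i + d i); split=> [i|].
      by apply: (mem_mD hm) => //; apply: mem_m_mull.
    rewrite c2 d2 scaler_sumr -big_split /=; apply/eqP; rewrite subr_eq0; apply/eqP.
    by apply: eq_bigr => i _; rewrite scalerDl scalerA.
  move=> _ /allpairsP [[a b] [/= az /(nthP 0) [j js <-] ->]].
  exists (fun i => if i == j then a else 0); split=> [i|].
    by case: ifP => _; [apply: zm | case: (m_submod hm)].
  rewrite (bigD1 (Ordinal js)) //= eqxx big1 ?addr0 => [|i ij]; first exact: subrr.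
  by rewrite ifN ?scale0r //; apply: contra ij => /eqP e; apply/eqP/val_inj.
have mT a : a \in m -> a ^+ T = 0.
  move=> am; have : J T (a ^+ T).
    elim: (T) => [|t IH]; first by apply: span_mem; rewrite inE.
    by rewrite exprS; apply: JS.
  case=> c ->; rewrite big1 // => i _; rewrite (J0 _`_i) ?scaler0 //.
  exact: mem_nth.
move=> [d d0 [p [pp pS]]].
have [[[p00 p01 p0D] p0P] [p1I _]] := (pp 0%N isT, pp 1%N d0).
have [_] := pS 0%N d0; apply=> a ap1.
have am : a \in m.
  case: p1I => p10 p11 p1D.
  apply: (@proper_in_m _ hR _ hm (fun x => x \in p 1%N)) ap1; last exact/negP.
  by split=> // c x y hx hy; apply: p1D.
have : a ^+ T \in p 0%N by rewrite mT.
elim: (T) => [|t IH]; first by rewrite expr0 (negbTE p01).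
by rewrite exprS => /p0P /orP [].
Qed.

Lemma finite_radius_dim0 : finite_radius X -> ~ krull_dim_gt R 0.
Proof.
move=> [r [[C hC XC] _]].
have [t tC] := torsion_bound_fin_gen hR m hC.
have [s sR] := torsion_bound_fin_gen hR m (fin_gen_regular R).
apply: (@torsion_bound_dim0 (maxn s t * r.+1)) => M /XC.
apply: torsion_bound_ball.
  by apply: torsion_bound_le sR; rewrite leq_maxl.
by apply: torsion_bound_le tC; rewrite leq_maxr.
Qed.

End FiniteLength.

(** * Independence of the resolution *)

Section ExtVanishing.
Variable R : comNzRingType.
Implicit Types (A B K L M N P Q : lmodType R).

(** Vanishing of Ext^(i+1)(N, R), computed with all projective presentations. *)
Fixpoint ext_zero i N : Prop :=
  if i is i'.+1 then
    forall K P (j : {linear K -> P}) (p : {linear P -> N}),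
      projective P -> short_exact j p -> ext_zero i' K
  else ext1_zero N.

(** Vanishing of Ext^(i+1)(N, R), computed with some projective presentation. *)
Fixpoint ext_zero_some i N : Prop :=
  if i is i'.+1 then
    exists K P (j : {linear K -> P}) (p : {linear P -> N}),
      [/\ projective P, short_exact j p & ext_zero_some i' K]
  else ext1_zero N.

(** K is a retract of L in the stable category. *)
Definition stable_retract K L : Prop :=
  exists (u : {linear K -> L}) (v : {linear L -> K}) P (a : {linear K -> P})
    (b : {linear P -> K}),
    projective P /\ forall x, v (u x) = x + b (a x).

(** Given an extension B of K, a functional extends to the pullback of B along v,
    and x |-> (x + c(a(p(x))), u(p(x))) maps B to this pullback, where c lifts b. *)
Lemma stable_retract_ext1_zero K L : stable_retract K L -> ext1_zero L -> ext1_zero K.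
Proof.
move=> [u [v [P [a [b [hP hvu]]]]]] hL A B i p [i1 ip p1] f.
have [c hc] := hP _ _ p b p1.
(* The pullback of B along v. *)
have [T [t [t1 tE]]] := submodule_exists
  (ker_submod (pair_map p (\- v : {linear L -> K}))).
have {}tE x y : p x = v y <-> exists w, t w = (x, y).
  rewrite -tE /=; split=> [-> | /subr0_eq //]; exact: subrr.
have [x|i' hi'] := factor_inj (g := in_left B L \o i) t1.
  by apply/tE; rewrite (exact_comp0 _ ip) linear0.
have hT : short_exact i' (snd \o t).
  split.
  - by move=> x y e; apply: i1; have := congr1 t e; rewrite !hi' => -[].
  - move=> w; split=> [/= e | [x <-]]; last by rewrite /= hi'.
    have : p (t w).1 = v (t w).2 by apply/tE; exists w; case: (t w).
    rewrite e linear0 => /ip [x ix]; exists x; apply: t1; rewrite hi' /= ix -e.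
    by case: (t w).
  - move=> y; have [x px] := p1 (v y).
    by have /tE [w tw] := px; exists w; rewrite /= tw.
have [g hg] := hL _ _ _ _ hT f.
have hl : linear (fun x => (x + c (a (p x)), u (p x)) : (B * L)%type).
  move=> r x y; rewrite !linearP; congr pair.
  by rewrite /= scalerDr addrACA.
have [x|h hh] := factor_inj (g := mk_linear hl) t1.
  by apply/tE; rewrite hvu linearD hc.
exists (g \o h) => x; rewrite /= -hg; congr (g _); apply: t1.
by rewrite hh hi' /= (exact_comp0 _ ip) !linear0 addr0.
Qed.

Lemma stable_retract_syzygy K L K' P' L' P (j : {linear K' -> P'}) (p : {linear P' -> K})
    (j0 : {linear L' -> P}) (q : {linear P -> L}) :
  projective P' -> projective P -> short_exact j p -> short_exact j0 q ->
  stable_retract K L -> stable_retract K' L'.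
Proof.
move=> hP' hP [j1 jp p1] [j01 jq q1] [u [v [T [a [b [hT hvu]]]]]].
have [U hU] := hP' _ _ q (u \o p) q1.
have [V hV] := hP _ _ p (v \o q) p1.
have [c hc] := hT _ _ p b p1.
have [x|u' hu'] := factor_inj (g := U \o j) j01.
  by apply/jq; rewrite hU /= (exact_comp0 _ jp) linear0.
have [x|v' hv'] := factor_inj (g := V \o j0) j1.
  by apply/jp; rewrite hV /= (exact_comp0 _ jq) linear0.
pose d : {linear P' -> P'} := (V \o U) \- (idfun \+ (c \o (a \o p))).
have dE x : d x = V (U x) - (x + c (a (p x))) by [].
have [x|t ht] := factor_inj (g := d) j1.
  apply/jp; rewrite dE linearB hV /= hU /= hvu linearD hc.
  exact: subrr.
exists u', v', P', j, t; split=> // x; apply: j1.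
rewrite hv' /= hu' /= linearD ht dE (exact_comp0 _ jp) !linear0 addr0.
by rewrite addrCA subrr addr0.
Qed.

Lemma ext_zero_stable i K L : stable_retract K L -> ext_zero_some i L -> ext_zero i K.
Proof.
elim: i K L => [|i IH] K L; first exact: stable_retract_ext1_zero.
move=> hKL [L' [P [j0 [q [hP hq hL']]]]] K' P' j p hP' hp.
exact: IH (stable_retract_syzygy hP' hP hp hq hKL) hL'.
Qed.

Lemma ext_zero_of_some i N : ext_zero_some i N -> ext_zero i N.
Proof.
apply: ext_zero_stable; exists idfun, idfun, 'rV[R]_0, \0, \0.
split; first exact: projective_free.
by move=> x; rewrite /= addr0.
Qed.

Lemma resolution_kernel N (P : proj_resolution N) :
  exists K (j : {linear K -> res_mod P 0}) (e : {linear res_mod P 1 -> K}),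
    [/\ short_exact j (res_aug P), onto e & forall x, j (e x) = res_diff P 0 x].
Proof.
have [K [j hj]] := kernel_exists (@res_aug_onto _ _ P); have [j1 jp _] := hj.
have [x|e he] := factor_inj (g := res_diff P 0) j1.
  by apply/jp/(@res_exact0 _ _ P); exists x.
exists K, j, e; split=> // x.
have /(@res_exact0 _ _ P) [y yx] := exact_comp0 x jp.
by exists y; apply: j1; rewrite he.
Qed.

Lemma ext_zero_some_of_resolution i N (P : proj_resolution N) :
  Hom_cohomology_eq0 R^o P i.+1 -> ext_zero_some i N.
Proof.
elim: i N P => [|i IH] N P hP; have [K [j [e [hj e1 he]]]] := resolution_kernel P;
  have [j1 _ _] := hj.
  apply: (ext1_zero_presentation hj (@res_proj _ _ P 0)) => f.
  have [x|g hg] := hP (f \o e).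
    rewrite /= (_ : e _ = 0) ?linear0 //; apply: j1; rewrite he linear0.
    by apply/(@res_exact _ _ P _); exists x.
  exists g => x; have [y <-] := e1 x; rewrite he.
  exact: hg.
have tail0 : exact_at (res_diff P 1) e.
  move=> x; rewrite -(@res_exact _ _ P 0) -he; split=> [-> | h]; first exact: linear0.
  by apply: j1; rewrite h linear0.
pose tail : proj_resolution K := @ProjResolution _ K (fun n => res_mod P n.+1)
  (fun n => res_diff P n.+1) e (fun n => @res_proj _ _ P n.+1) e1 tail0
  (fun n => @res_exact _ _ P n.+1).
exists K, (res_mod P 0), j, (res_aug P); split=> //; first exact: res_proj.
exact: (IH K tail hP).
Qed.

Lemma Ext_eq0_ext_zero i N : Ext_eq0 i.+1 N R^o -> ext_zero i N.
Proof. by move=> [P hP]; apply/ext_zero_of_some/(ext_zero_some_of_resolution hP). Qed.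

Hypothesis hR : noetherian R.

Lemma ext_zero_dual_syzygy n N : fin_gen N -> (forall i, ext_zero i N) ->
  is_nth_syzygy n (dual N).
Proof.
elim: n N => // n IH N hN h.
have [r [y [K [j hj]]]] := fin_gen_presentation hN.
have [a [ha _]] := dual_sequence hj (h 0%N _ _ _ _ hj).
exists r, (dual K), a, (row_pairing_map j); split=> //; apply: IH.
  by case: (hj) => j1 _ _; apply: fin_gen_inj hR j1 (fin_gen_free R r).
by move=> i; apply: (h i.+1 _ _ _ _ (@projective_free R r) hj).
Qed.

Lemma nth_syzygy_inj n M N (f : {linear M -> N}) :
  bijective f -> is_nth_syzygy n N -> is_nth_syzygy n M.
Proof.
case: n => // n hf [r [B [i [p [[i1 ip p1] hB]]]]].
exists r, B, (i \o f), p; split=> //; split=> //.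
  by move=> x y /i1 /(bij_inj hf).
move=> y; rewrite ip; split=> [[x <-] | [x <-]]; last by exists (f x).
by have [z <-] := bij_onto hf x; exists z.
Qed.

Lemma totally_reflexive_syzygy n M : totally_reflexive M -> is_nth_syzygy n M.
Proof.
move=> [hM hb _ hE].
have bl : linear (@biduality R M).
  by move=> a x y; apply: homP => f; apply: (linearP (f : {linear M -> R^o})).
apply: (@nth_syzygy_inj _ _ _ (mk_linear bl)) => //.
apply: ext_zero_dual_syzygy; first exact: fin_gen_dual.
by move=> i; apply: Ext_eq0_ext_zero; apply: hE.
Qed.

End ExtVanishing.

(** * Regular sequences and chains of prime ideals *)

Section PrimeChains.
Variable R : comNzRingType.
Hypothesis hR : noetherian R.
Variable m : {pred R}.
Hypothesis hm : local_ring m.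
Variable M : lmodType R.
Implicit Types (S : M -> Prop) (s : seq R).

Lemma colon_submod S x : is_submod S -> is_submod (fun a : R^o => S ((a : R) *: x)).
Proof.
move=> hS; split; first by rewrite scale0r; case: hS.
by move=> a b c hb hc; rewrite scalerDl -scalerA; case: hS => _; apply.
Qed.

(** Every prime ideal p containing (S : y) contains an associated prime of M/S: a
    maximal element among the ideals (S : z) contained in p is prime. *)
Lemma colon_prime S (p : R -> Prop) y : is_submod S ->
  (forall a b, p (a * b) -> p a \/ p b) ->
  (forall a, S (a *: y) -> p a) ->
  exists z, (forall a, S (a *: z) -> p a) /\
    forall a b, S ((a * b) *: z) -> S (a *: z) \/ S (b *: z).
Proof.
move=> hS hp hy.
pose col z : R^o -> Prop := fun a => S ((a : R) *: z).
have [||T [[z [-> zp]] zmax]] := @noeth_maximal _ R^o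
    (fun T => exists z, T = col z /\ forall a, col z a -> p a) (noeth_ring hR).
- by move=> _ [z [-> _]]; apply: colon_submod.
- by exists (col y), y.
exists z; split=> // a b hab.
have [hb | hb] := pselect (S (b *: z)); [by right | left].
apply: contrapT => ha.
have [c hc pc] : exists2 c, S (c *: (b *: z)) & ~ p c.
  apply: contrapT => h; apply: ha.
  apply: (zmax (col (b *: z))); last by rewrite /col scalerA.
    exists (b *: z); split=> // c hc; apply: contrapT => pc; apply: h.
    by exists c.
  by move=> c hc; rewrite /col scalerA mulrC -scalerA; apply: submodZ.
apply: hb; apply: (zmax (col (c *: z))).
- exists (c *: z); split=> // e; rewrite /col scalerA => /zp /hp [] //.
- by move=> e he; rewrite /col scalerA mulrC -scalerA; apply: submodZ.
- by rewrite /col scalerA mulrC -scalerA.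
Qed.

(** With N_i the submodule generated by the first i terms, the primes of the form
    (N_i : z) grow strictly with i: the next term lies in (N_(i+1) : z) and is
    regular modulo N_i. *)
Lemma regular_sequence_chain s : {subset s <= m} -> regular_sequence M s ->
  prime_chain R (size s).
Proof.
move=> sm [sreg [y hy]].
pose col i (z : M) (a : R) := in_ideal_mul (take i s) (a *: z).
have colS i z := colon_submod z (ideal_mul_submod M (take i s)).
pose prime_col i z :=
  ~ col i z 1 /\ forall a b, col i z (a * b) -> col i z a \/ col i z b.
have chain i z : (i <= size s)%N -> prime_col i z ->
    exists p : nat -> {pred R},
    [/\ forall j, (j <= i)%N -> prime_ideal (p j),
        forall j, (j < i)%N -> {subset p j <= p j.+1} /\ ~ {subset p j.+1 <= p j}
      & forall a, a \in p i <-> col i z a].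
  elim: i z => [|i IH] z hi [z1 zp].
    pose q : {pred R} := fun a => `[<col 0%N z a>].
    exists (fun=> q); split=> // [j _|a]; last by split=> /asboolP.
    split; [split | ].
    - by apply/asboolP; case: (colS 0%N z).
    - exact/asboolP.
    - by move=> a u v /asboolP hu /asboolP hv; apply/asboolP; case: (colS 0%N z) => _; apply.
    - by move=> a b /asboolP /zp [] h; apply/orP; [left | right]; apply/asboolP.
  have sub a : col i z a -> col i.+1 z a.
    by move=> h; rewrite /col (take_nth 0) //; apply/ideal_mul_rcons;
       exists (a *: z), 0; rewrite scaler0 addr0.
  have [w [wz wp]] := colon_prime (ideal_mul_submod M (take i s)) zp sub.
  have w1 : ~ col i w 1 by move/wz.
  have [p [pP pS pE]] := IH w (ltnW hi) (conj w1 wp).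
  pose q : {pred R} := fun a => `[<col i.+1 z a>].
  exists (fun j => if j == i.+1 then q else p j); split.
  - move=> j; rewrite leq_eqVlt ltnS; case: eqVneq => [_ _|_ /= ji]; last exact: pP.
    split; [split | ].
    + by apply/asboolP; case: (colS i.+1 z).
    + exact/asboolP.
    + by move=> a u v /asboolP hu /asboolP hv; apply/asboolP; case: (colS i.+1 z) => _; apply.
    + by move=> a b /asboolP /zp [] h; apply/orP; [left | right]; apply/asboolP.
  - move=> j; rewrite ltnS leq_eqVlt eqSS => /orP [/eqP -> | ji]; last first.
      by rewrite (ltn_eqF ji) (ltn_eqF (leqW ji)); apply: pS.
    rewrite eqxx ltn_eqF //; split=> [a /pE /wz h | h]; first exact/asboolP.
    apply: w1; rewrite /col scale1r; apply: sreg (hi) _ _.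
    apply/pE/h/asboolP; rewrite /col (take_nth 0) //.
    by apply: ideal_mul_mem; rewrite mem_rcons inE eqxx.
  - by move=> a; rewrite eqxx; split=> /asboolP.
have [||z [zm zp]] := @colon_prime (in_ideal_mul s) (fun a => a \in m) y
  (ideal_mul_submod M s).
- move=> a b hab; have [ha | ha] := boolP (a \in m); [by left | right].
  have [c ca] := local_unit hR hm ha.
  by rewrite -[b]mul1r -ca -mulrA; apply: mem_m_mull.
- apply: (proper_in_m hR hm (colon_submod y (ideal_mul_submod M s))).
  by rewrite scale1r.
have [|p [p1 p2 _]] := chain (size s) z (leqnn _); last by exists p.
rewrite /prime_col /col take_size; split=> // /zm.
exact/negP/(m_one hm).
Qed.

End PrimeChains.

(** * Cohen-Macaulay rings and the theorem *)

Section CohenMacaulay.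
Variable R : comNzRingType.
Hypothesis hR : noetherian R.
Variable m : {pred R}.
Hypothesis hm : local_ring m.

Lemma totally_reflexive_maximal_CM (M : lmodType R) :
  CM_ring m -> totally_reflexive M -> maximal_CM m M.
Proof.
move=> [d hd [[s [sm [sreg _] ss]] _]] hM; have fgM : fin_gen M by case: hM.
split=> //; have [M0 | M0] := pselect (zero_module M); [by left | right].
exists d => //; split.
  exists s; split=> //; split.
    exact: (weakly_regular_syzygy (totally_reflexive_syzygy hR (size s) hM)).
  apply: contrapT => h; apply: M0.
  apply: (@nakayama _ hR _ hm _ (fun x => x = 0) s fgM) => //.
    by split=> // a x y -> ->; rewrite scaler0 addr0.
  move=> x; exists x; split; last exact: subrr.
  by apply: contrapT => hx; apply: h; exists x.
move=> t tm ht; case: hd => _; apply.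
exact: (regular_sequence_chain hR hm tm ht).
Qed.

End CohenMacaulay.

Lemma resolving_dichotomy (R : comNzRingType) (hR : noetherian R)
    (m : {pred R}) (hm : local_ring m)
    (k : lmodType R) (hk : residue_field m k)
    (X : subcat R) (hX : resolving X) (hcosyz : closed_under_cosyzygies X) :
  X k \/ subcat_le X (@totally_reflexive R).
Proof.
have [Xk | Xk] := pselect (X k); [by left | right] => M XM.
apply: (resolving_totally_reflexive hR hm hX hcosyz) XM => N XN.
  exact: (resolving_torsionless hR hm hX hcosyz hk Xk).
exact: (resolving_ext1_zero hR hm hX hcosyz hk Xk).
Qed.

Theorem theorem1p3 (R : comNzRingType) (hR : noetherian R)
    (m : {pred R}) (hm : local_ring m)
    (k : lmodType R) (hk : residue_field m k)
    (X : subcat R) (hX : resolving X) (hcosyz : closed_under_cosyzygies X) :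
  (X k \/ subcat_le X (@totally_reflexive R)) /\
  (krull_dim_gt R 0 -> finite_radius X ->
     subcat_le X (@totally_reflexive R) /\
     (CM_ring m -> subcat_le X (maximal_CM m))).
Proof.
have dich := resolving_dichotomy hR hm hk hX hcosyz; split=> // dimR rad.
have XG : subcat_le X (@totally_reflexive R).
  case: dich => // Xk; case: (finite_radius_dim0 hR hm hX hk Xk rad dimR).
split=> // hCM M /XG; exact: (totally_reflexive_maximal_CM hR hm).
Qed.
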